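(* Let $S$ be an additive abelian group and $\chi:S\to\mathbb{C}^{\times}$ a group homomorphism. The correspondence $$\mathbf{c}\mapsto\tfrac12\mathbf{k},\qquad D_{\alpha,m}\mapsto L_{\alpha,0}(m)_{\tilde S_D}\quad\text{for }\alpha\in S,\ m\in\mathbb{Z},$$ gives a Lie algebra isomorphism from $\widehat{D}_S$ to the $(\tilde S_D,\tilde\chi_D)$-covariant algebra $\widehat{\mathcal{L}_S}[\tilde S_D]$, where $a(m)_{\tilde S_D}$ denotes the image of $a\otimes t^m$ in $\widehat{\mathcal{L}_S}[\tilde S_D]$ for $a\in\mathcal{L}_S$.
   Context: All vector spaces are over $\mathbb{C}$. The Lie algebra $\widehat{A}_S$: generated by $\mathbf{c}$ and $A_{\alpha,m}$ ($\alpha\in S$, $m\in\mathbb{Z}$) subject to the relations that $\mathbf{c}$ is central and $$[A_{\alpha,m},A_{\beta,n}]=(\chi(m\beta-n\alpha)-\chi(n\alpha-m\beta))A_{\alpha+\beta,m+n}+m\delta_{\alpha+\beta,0}\delta_{m+n,0}\mathbf{c};$$ these generators form a basis. $\tau_D$ is the order-2 automorphism of $\widehat{A}_S$ with $\tau_D(\mathbf{c})=\mathbf{c}$, $\tau_D(A_{\alpha,m})=-\chi(2\alpha)A_{-\alpha,m}$; $\widehat{D}_S$ is the subalgebra of $\tau_D$-fixed points, and $D_{\alpha,m}=A_{\alpha,m}+\tau_D(A_{\alpha,m})=A_{\alpha,m}-\chi(2\alpha)A_{-\alpha,m}$. The algebra $\mathcal{L}_S$: the associative algebra with basis $\{L_{\alpha,\beta}\mid\alpha,\beta\in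 S\}$ and product $L_{\alpha,\beta}L_{\mu,\nu}=\delta_{\alpha+\mu,\beta-\nu}L_{\alpha+\mu,\alpha+\nu}$, viewed as a Lie algebra under the commutator, with the symmetric invariant bilinear form $\langle L_{\alpha,\beta},L_{\mu,\nu}\rangle=\delta_{\alpha+\mu,0}\delta_{\beta,\nu}$. $S$ acts on $\mathcal{L}_S$ by $\sigma_\gamma(L_{\alpha,\beta})=L_{\alpha,\beta+\gamma}$, and $\tau_\chi$ is the order-2 Lie algebra automorphism $\tau_\chi(L_{\alpha,\beta})=-\chi(2\alpha)L_{-\alpha,\beta}$; these commute and preserve the form. Affine Lie algebra: $\widehat{\mathfrak g}=\mathfrak g\otimes\mathbb{C}[t,t^{-1}]\oplus\mathbb{C}\mathbf{k}$ with $\mathbf{k}$ central and $[a\otimes t^m,b\otimes t^n]=[a,b]\otimes t^{m+n}+m\langle a,b\rangle\delta_{m+n,0}\mathbf{k}$. The group $\tilde S_D$: let $\gamma\in S$ act on $\widehat{\mathcal{L}_S}$ by $\mathbf{k}\mapsto\mathbf{k}$, $a\otimes t^n\mapsto\chi(\gamma)^n(\sigma_\gamma(a)\otimes t^n)$, and let $\hat\tau_\chi$ be the automorphism $\mathbf{k}\mapsto\mathbf{k}$, $a\otimes t^n\mapsto\tau_\chi(a)\otimes t^n$. Put $\tilde S_D=\langle S,\hat\tau_\chi\rangle=S\times\langle\hat\tau_\chi\rangle$, acting on $\mathcal{L}_S$ with $\gamma\in S$ acting as $\sigma_\gamma$ and $\hat\tau_\chi$ acting as $\tau_\chi$. The character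 $\tilde\chi_D:\tilde S_D\to\mathbb{C}^\times$ is given by $\tilde\chi_D(\hat\tau_\chi)=1$, $\tilde\chi_D(\gamma)=\chi(\gamma)$ for $\gamma\in S$. Covariant algebra: let a group $\Gamma$ act on $\mathfrak g$ by automorphisms preserving $\langle\cdot,\cdot\rangle$ such that for all $a,b\in\mathfrak g$, $[ga,b]=0$ and $\langle ga,b\rangle=0$ for all but finitely many $g\in\Gamma$, and let $\phi:\Gamma\to\mathbb{C}^\times$ be a homomorphism. On the vector space $\widehat{\mathfrak g}$ define $[\cdot,\cdot]_\Gamma$ by $[\mathbf{k},\widehat{\mathfrak g}]_\Gamma=0=[\widehat{\mathfrak g},\mathbf{k}]_\Gamma$ and $$[a\otimes t^m,b\otimes t^n]_\Gamma=\sum_{g\in\Gamma}\phi(g)^m\big([ga,b]\otimes t^{m+n}+m\langle ga,b\rangle\delta_{m+n,0}\mathbf{k}\big).$$ The span $I_\Gamma$ of all $\phi(g)^m(ga\otimes t^m)-a\otimes t^m$ is a two-sided ideal and $\widehat{\mathfrak g}[\Gamma]:=\widehat{\mathfrak g}/I_\Gamma$ is a Lie algebra, called the $(\Gamma,\phi)$-covariant algebra of $\widehat{\mathfrak g}$; the image of $\mathbf{k}$ (nonzero) is again denoted $\mathbf{k}$. *)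

(* Defs.v *)
From HB Require Import structures.
From mathcomp Require Import all_boot all_order all_algebra finmap.
From mathcomp Require Import ring.
From mathcomp Require Import boolp classical_sets functions cardinality fsbigop.
From mathcomp Require Import reals.
From mathcomp Require Import complex monalg.

Set Implicit Arguments.
Unset Strict Implicit.
Unset Printing Implicit Defensive.

Import GRing.Theory Num.Theory.
Local Open Scope classical_set_scope.
Local Open Scope ring_scope.

HB.mixin Record Lmodule_isLie (K : nzRingType) L of GRing.Lmodule K L := {
  lie : L -> L -> L;
  lieDZl : forall (c : K) (x y z : L),
    lie (c *: x + y) z = c *: lie x z + lie y z;
  lieDZr : forall (c : K) (x y z : L),
    lie x (c *: y + z) = c *: lie x y + lie x z;
  liexx : forall x : L, lie x x = 0;
  lie_jacobi : forall x y z : L,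
    lie x (lie y z) + lie y (lie z x) + lie z (lie x y) = 0
}.

#[short(type="lieType")]
HB.structure Definition LieAlgebra (K : nzRingType) :=
  {L of Lmodule_isLie K L & GRing.Lmodule K L}.

Definition lie_isomorphism (K : nzRingType) (L M : lieType K)
    (f : {linear L -> M}) : Prop :=
  (forall x y, f (lie x y) = lie (f x) (f y)) /\ bijective f.

(* A homomorphism from an additive group to the multiplicative group of a
   field; nonvanishing follows from the two equations. *)
Record character (S : zmodType) (K : fieldType) := Character {
  char_fun :> S -> K;
  char0 : char_fun 0 = 1;
  charD : {morph char_fun : x y / x + y >-> x * y}
}.

Section LieTheory.
Variables (K : nzRingType) (L : lieType K).
Implicit Types x y z : L.

Lemma lieDl x y z : lie (x + y) z = lie x z + lie y z.
Proof. by rewrite -[x]scale1r lieDZl !scale1r. Qed.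

Lemma lieDr x y z : lie x (y + z) = lie x y + lie x z.
Proof. by rewrite -[y]scale1r lieDZr !scale1r. Qed.

Lemma lie0l x : lie 0 x = 0.
Proof. by apply: (addrI (lie 0 x)); rewrite -lieDl !addr0. Qed.

Lemma lie0r x : lie x 0 = 0.
Proof. by apply: (addrI (lie x 0)); rewrite -lieDr !addr0. Qed.

Lemma lieZl c x y : lie (c *: x) y = c *: lie x y.
Proof. by rewrite -[c *: x]addr0 lieDZl lie0l addr0. Qed.

Lemma lieZr c x y : lie x (c *: y) = c *: lie x y.
Proof. by rewrite -[c *: y]addr0 lieDZr lie0r addr0. Qed.

Lemma lieC x y : lie x y = - lie y x.
Proof.
by apply/eqP; rewrite -addr_eq0 -(liexx (x + y)) lieDl !lieDr !liexx add0r addr0.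
Qed.

Lemma lieNl x y : lie (- x) y = - lie x y.
Proof. by rewrite -scaleN1r lieZl scaleN1r. Qed.

Lemma lieNr x y : lie x (- y) = - lie x y.
Proof. by rewrite -scaleN1r lieZr scaleN1r. Qed.

Lemma lie_leibniz x y z :
  lie x (lie y z) = lie (lie x y) z + lie y (lie x z).
Proof.
have /eqP := lie_jacobi x y z; rewrite (lieC z x) (lieC z (lie x y)) lieNr.
by rewrite -addrA -opprD subr_eq0 addrC => /eqP.
Qed.

End LieTheory.

Section Extension.

Lemma malg_add_ind (I : choiceType) (G : zmodType) (P : {malg G[I]} -> Prop) :
  P 0 -> (forall u v, P u -> P v -> P (u + v)) ->
  (forall a i, P << a *g i >>) -> forall u, P u.
Proof.
move=> P0 PD PU u; rewrite (monalgE u).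
by apply: (big_ind P) => // i _; apply: PU.
Qed.

(* Biadditive extension of [B i a j b], the value on a in degree i and b in
   degree j. *)
Definition ext2 (I J : choiceType) (G H V : zmodType)
    (B : I -> G -> J -> H -> V) (u : {malg G[I]}) (v : {malg H[J]}) : V :=
  \sum_(i <- msupp u) \sum_(j <- msupp v) B i u@_i j v@_j.

Section Ext2.
Variables (I J : choiceType) (G H V : zmodType) (B : I -> G -> J -> H -> V).
Hypothesis BDl : forall i a a' j b, B i (a + a') j b = B i a j b + B i a' j b.
Hypothesis BDr : forall i a j b b', B i a j (b + b') = B i a j b + B i a j b'.

Let B0l i j b : B i 0 j b = 0.
Proof. by apply: (addrI (B i 0 j b)); rewrite -BDl !addr0. Qed.

Let B0r i a j : B i a j 0 = 0.
Proof. by apply: (addrI (B i a j 0)); rewrite -BDr !addr0. Qed.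

Lemma ext2w (d1 : {fset I}) (d2 : {fset J}) u v :
  (msupp u `<=` d1)%fset -> (msupp v `<=` d2)%fset ->
  ext2 B u v = \sum_(i <- d1) \sum_(j <- d2) B i u@_i j v@_j.
Proof.
move=> le1 le2; rewrite /ext2 (big_fset_incl _ le1) /=; last first.
  by move=> i _ /mcoeff_outdom ->; rewrite big1 // => j _; rewrite B0l.
apply: eq_bigr => i _; apply: big_fset_incl => // j _ /mcoeff_outdom ->.
by rewrite B0r.
Qed.

Lemma ext2Dl u u' v : ext2 B (u + u') v = ext2 B u v + ext2 B u' v.
Proof.
have h := fsubset_refl (msupp v).
rewrite (ext2w (msuppD_le u u') h) (ext2w (fsubsetUl _ (msupp u')) h).
rewrite (ext2w (fsubsetUr (msupp u) _) h) -big_split /=; apply: eq_bigr => i _.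
by rewrite -big_split; apply: eq_bigr => j _; rewrite mcoeffD BDl.
Qed.

Lemma ext2Dr u v v' : ext2 B u (v + v') = ext2 B u v + ext2 B u v'.
Proof.
have h := fsubset_refl (msupp u).
rewrite (ext2w h (msuppD_le v v')) (ext2w h (fsubsetUl _ (msupp v'))).
rewrite (ext2w h (fsubsetUr (msupp v) _)) -big_split /=; apply: eq_bigr => i _.
by rewrite -big_split; apply: eq_bigr => j _; rewrite mcoeffD BDr.
Qed.

Lemma ext20l v : ext2 B 0 v = 0.
Proof. by apply: (addrI (ext2 B 0 v)); rewrite -ext2Dl !addr0. Qed.

Lemma ext20r u : ext2 B u 0 = 0.
Proof. by apply: (addrI (ext2 B u 0)); rewrite -ext2Dr !addr0. Qed.

Lemma ext2UU a i b j : ext2 B << a *g i >> << b *g j >> = B i a j b.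
Proof. by rewrite (ext2w msuppU_le msuppU_le) !big_seq_fset1 !mcoeffUU. Qed.

End Ext2.

End Extension.

Section LinearExtension.
Variables (K : comNzRingType) (I J : choiceType).
Implicit Type V : lmodType K.

Definition lin_ext V (f : I -> V) (u : {malg K[I]}) : V :=
  \sum_(i <- msupp u) u@_i *: f i.

Definition bilin_ext V (b : I -> J -> V) (u : {malg K[I]}) (v : {malg K[J]}) :
    V :=
  \sum_(i <- msupp u) \sum_(j <- msupp v) (u@_i * v@_j) *: b i j.

Lemma malg_scaleU (c : K) (i : I) : << c *g i >> = c *: << i >> :> {malg K[I]}.
Proof. by apply/malgP => k; rewrite mcoeffZ !mcoeffU mulrnAr mulr1. Qed.

Lemma malg_lin_ind (P : {malg K[I]} -> Prop) :
  P 0 -> (forall c u v, P u -> P v -> P (c *: u + v)) ->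
  (forall i, P << i >>) -> forall u, P u.
Proof.
move=> P0 PL PU; apply: malg_add_ind => // [u v Pu Pv|a i].
  by rewrite -[u]scale1r; apply: PL.
by rewrite malg_scaleU -[_ *: _]addr0; apply: PL.
Qed.

Lemma lin_ext_linear V (f : I -> V) : linear (lin_ext f).
Proof.
have w (d : {fset I}) u : (msupp u `<=` d)%fset ->
    lin_ext f u = \sum_(i <- d) u@_i *: f i.
  move=> le; apply: big_fset_incl => // i _ /mcoeff_outdom ->.
  by rewrite scale0r.
move=> c u v; set d := (msupp u `|` msupp v)%fset.
have le : (msupp (c *: u + v) `<=` d)%fset.
  apply: fsubset_trans (msuppD_le _ _) _.
  by apply: fsetSU; apply: msuppZ_le.
rewrite (w d _ le) (w d u) ?fsubsetUl // (w d v) ?fsubsetUr //.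
rewrite scaler_sumr -big_split /=; apply: eq_bigr => i _.
by rewrite mcoeffD mcoeffZ scalerDl scalerA.
Qed.

HB.instance Definition _ V (f : I -> V) :=
  GRing.isLinear.Build K {malg K[I]} V _ (lin_ext f) (lin_ext_linear f).

Lemma lin_extU V (f : I -> V) i : lin_ext f << i >> = f i.
Proof.
rewrite /lin_ext msuppU; case: eqP => [/eqP|_]; first by rewrite oner_eq0.
by rewrite big_seq_fset1 mcoeffUU scale1r.
Qed.

Section Bilin.
Variables (V : lmodType K) (b : I -> J -> V).

Let B (i : I) (x : K) (j : J) (y : K) := (x * y) *: b i j.
Let BDl i a a' j c : B i (a + a') j c = B i a j c + B i a' j c.
Proof. by rewrite /B mulrDl scalerDl. Qed.
Let BDr i a j c c' : B i a j (c + c') = B i a j c + B i a j c'.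
Proof. by rewrite /B mulrDr scalerDl. Qed.
Let bE u v : bilin_ext b u v = ext2 B u v. Proof. by []. Qed.

Lemma bilin_extUU i j : bilin_ext b << i >> << j >> = b i j.
Proof. by rewrite bE ext2UU // /B mulr1 scale1r. Qed.

Lemma bilin_extl (v : {malg K[J]}) : linear (bilin_ext b ^~ v).
Proof.
move=> c u u'; rewrite !bE ext2Dl //; congr (_ + _).
rewrite (ext2w BDl BDr (msuppZ_le c u) (fsubset_refl _)) /ext2.
rewrite scaler_sumr; apply: eq_bigr => i _.
rewrite scaler_sumr; apply: eq_bigr => j _.
by rewrite /B mcoeffZ scalerA mulrA.
Qed.

Lemma bilin_extr (u : {malg K[I]}) : linear (bilin_ext b u).
Proof.
move=> c v v'; rewrite !bE ext2Dr //; congr (_ + _).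
rewrite (ext2w BDl BDr (fsubset_refl _) (msuppZ_le c v)) /ext2.
rewrite scaler_sumr; apply: eq_bigr => i _.
rewrite scaler_sumr; apply: eq_bigr => j _.
by rewrite /B mcoeffZ scalerA mulrCA.
Qed.

HB.instance Definition _ u :=
  GRing.isLinear.Build K {malg K[J]} V _ (bilin_ext b u) (bilin_extr u).

Lemma bilin_extDl u u' v :
  bilin_ext b (u + u') v = bilin_ext b u v + bilin_ext b u' v.
Proof. by have := bilin_extl v 1 u u'; rewrite !scale1r. Qed.
Lemma bilin_ext0l v : bilin_ext b 0 v = 0.
Proof. by apply: (addrI (bilin_ext b 0 v)); rewrite -bilin_extDl !addr0. Qed.
Lemma bilin_extZl c u v : bilin_ext b (c *: u) v = c *: bilin_ext b u v.
Proof. by have := bilin_extl v c u 0; rewrite bilin_ext0l !addr0. Qed.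

End Bilin.
End LinearExtension.

Lemma opp_fixed0 (K : numFieldType) (V : lmodType K) (x : V) : x = - x -> x = 0.
Proof.
move=> /eqP; rewrite -addr_eq0 -mulr2n -scaler_nat scaler_eq0 pnatr_eq0 /=.
by move/eqP.
Qed.

Section BasisBracket.
Variables (K : numFieldType) (I : choiceType).
Variable b : I -> I -> {malg K[I]}.
Local Notation br := (bilin_ext b).

Let brZr c u v : br u (c *: v) = c *: br u v. Proof. exact: linearZ. Qed.
Let brDr u v v' : br u (v + v') = br u v + br u v'. Proof. exact: linearD. Qed.
Let br0r u : br u 0 = 0. Proof. exact: linear0. Qed.
Let brE := (bilin_extDl, bilin_extZl, bilin_ext0l, brZr, brDr, br0r).

Lemma bilin_ext_alt : (forall i j, b i j = - b j i) -> forall u, br u u = 0.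
Proof.
move=> bC u; apply: opp_fixed0; move: {1 4}u => v; move: u.
elim/malg_lin_ind: v => [u|c v v' IH IH' u|i u].
- by rewrite !brE oppr0.
- by rewrite !brE IH IH' opprD scalerN.
elim/malg_lin_ind: u => [|c u u' IH IH'|j].
- by rewrite !brE oppr0.
- by rewrite !brE IH IH' opprD scalerN.
by rewrite !bilin_extUU bC.
Qed.

Lemma bilin_ext_jacobi :
    (forall i j k, br << i >> (b j k) + br << j >> (b k i) + br << k >> (b i j) = 0) ->
  forall u v w, br u (br v w) + br v (br w u) + br w (br u v) = 0.
Proof.
have aux c (x y z x' y' z' : {malg K[I]}) : x + y + z = 0 -> x' + y' + z' = 0 ->
    c *: x + x' + (c *: y + y') + (c *: z + z') = 0.
  move=> h h'; rewrite (addrACA (c *: x)) (addrACA (c *: x + c *: y)).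
  by rewrite -!scalerDr h h' scaler0 addr0.
move=> bJ; elim/malg_lin_ind => [v w|c u u' IH IH' v w|i].
- by rewrite !brE !addr0.
- by rewrite !brE; apply: aux.
elim/malg_lin_ind => [w|c u u' IH IH' w|j].
- by rewrite !brE !addr0.
- by rewrite !brE; apply: aux.
elim/malg_lin_ind => [|c u u' IH IH'|k].
- by rewrite !brE !addr0.
- by rewrite !brE; apply: aux.
by rewrite !bilin_extUU.
Qed.

End BasisBracket.

Lemma lcomb3 (K : nzRingType) (V : lmodType K) (k e q k' e' q' k'' e'' q'' : K)
    (x y : V) :
  k *: (e *: x + q *: y) + k' *: (e' *: x + q' *: y)
    + k'' *: (e'' *: x + q'' *: y)
  = (k * e + k' * e' + k'' * e'') *: x + (k * q + k' * q' + k'' * q'') *: y.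
Proof.
rewrite !scalerDr !scalerA !scalerDl.
by rewrite (addrACA ((k * e) *: x)) (addrACA ((k * e) *: x + _)).
Qed.

Section CharacterTheory.
Variables (S : zmodType) (K : fieldType) (chi : character S K).

Lemma char_neq0 x : chi x != 0.
Proof.
apply/eqP => h; have := char0 chi; rewrite -(subrr x) charD h mul0r.
by move/eqP; rewrite eq_sym oner_eq0.
Qed.

Lemma charN x : chi (- x) = (chi x)^-1.
Proof.
by apply: (mulfI (char_neq0 x)); rewrite -charD subrr char0 mulfV ?char_neq0.
Qed.

End CharacterTheory.

Section Ahat.
Variables (K : numFieldType) (S : zmodType).
Implicit Type chi : character S K.

(* [Some (alpha, m)] indexes the basis element A_{alpha,m}, [None] indexes c. *)
Definition Ahat chi : Type := {malg K[option (S * int)]}.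
HB.instance Definition _ chi := GRing.Lmodule.on (Ahat chi).

Definition Ac chi : Ahat chi := << None >>.
Definition Agen chi (alpha : S) (m : int) : Ahat chi := << Some (alpha, m) >>.

Definition Abracket chi (x y : option (S * int)) : Ahat chi :=
  match x, y with
  | Some (alpha, m), Some (beta, n) =>
      (chi (beta *~ m - alpha *~ n) - chi (alpha *~ n - beta *~ m))
          *: Agen chi (alpha + beta) (m + n)
        + (m%:~R * (alpha + beta == 0)%:R * (m + n == 0)%:R) *: Ac chi
  | _, _ => 0
  end.

Definition Alie chi : Ahat chi -> Ahat chi -> Ahat chi :=
  bilin_ext (Abracket chi).

Lemma AbracketC chi x y : Abracket chi x y = - Abracket chi y x.
Proof.
case: x y => [[a m]|] [[b n]|] /=; rewrite ?oppr0 //.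
rewrite opprD (addrC b) (addrC n); congr (_ + _).
  by rewrite -scaleNr opprB.
rewrite -scaleNr; congr (_ *: _).
case: (eqVneq (a + b) 0) => _; rewrite ?mulr0 ?mul0r ?oppr0 // !mulr1.
case: (eqVneq (m + n) 0) => [/eqP|_]; rewrite ?mulr0 ?oppr0 // !mulr1.
by rewrite addr_eq0 => /eqP ->; rewrite rmorphN.
Qed.

Lemma AliexxP chi u : Alie u u = 0 :> Ahat chi.
Proof. exact: bilin_ext_alt (@AbracketC chi) u. Qed.

Lemma Alie_genl chi a m b n :
  Alie (Agen chi a m) (Agen chi b n) = Abracket chi (Some (a, m)) (Some (b, n)).
Proof. exact: bilin_extUU. Qed.

Lemma AlieDZr chi c (u v w : Ahat chi) :
  Alie u (c *: v + w) = c *: Alie u v + Alie u w.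
Proof. exact: (bilin_extr (Abracket chi)). Qed.

Lemma AlieDZl chi c (u v w : Ahat chi) :
  Alie (c *: u + v) w = c *: Alie u w + Alie v w.
Proof. exact: (bilin_extl (Abracket chi)). Qed.

Lemma Alie_cr chi u : Alie u (Ac chi) = 0.
Proof.
elim/malg_lin_ind: u => [|c u v IH IH'|i]; first exact: bilin_ext0l.
  by rewrite AlieDZl IH IH' scaler0 addr0.
by rewrite /Alie bilin_extUU; case: i => [[]|].
Qed.

Lemma Alie0r chi (u : Ahat chi) : Alie u 0 = 0.
Proof. exact: (linear0 (bilin_ext (Abracket chi) u)). Qed.

Lemma AlieZr chi c (u v : Ahat chi) : Alie u (c *: v) = c *: Alie u v.
Proof. by have := AlieDZr c u v 0; rewrite Alie0r !addr0. Qed.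

Lemma Alie_gen_comb chi a m b n x y :
  Alie (Agen chi a m) (x *: Agen chi b n + y *: Ac chi)
  = x *: Abracket chi (Some (a, m)) (Some (b, n)).
Proof. by rewrite AlieDZr AlieZr Alie_cr Alie_genl scaler0 addr0. Qed.

Lemma Alie_Abracket chi c p a m b n x y z :
  chi (b *~ m - a *~ n) = x -> chi (a *~ p - c *~ m) = y ->
  chi (b *~ p - c *~ n) = z ->
  Alie (Agen chi c p) (Abracket chi (Some (a, m)) (Some (b, n))) =
  (x - x^-1) *: ((y * z - (y * z)^-1) *: Agen chi (a + b + c) (m + n + p)
    + (p%:~R * (a + b + c == 0)%:R * (m + n + p == 0)%:R) *: Ac chi).
Proof.
move=> ex ey ez; rewrite [Abracket _ _ _]/= Alie_gen_comb.
rewrite -(opprB (b *~ m)) charN ex; congr (_ *: _); rewrite /=.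
rewrite -(opprB ((a + b) *~ p)) charN.
have -> : (a + b) *~ p - c *~ (m + n) = (a *~ p - c *~ m) + (b *~ p - c *~ n).
  by rewrite mulrzDl mulrzDr opprD addrACA.
by rewrite charD ey ez (addrC c) (addrC p).
Qed.

Lemma Alie_cl chi u : Alie (Ac chi) u = 0.
Proof.
elim/malg_lin_ind: u => [|c u v IH IH'|i]; first exact: Alie0r.
  by rewrite AlieDZr IH IH' scaler0 addr0.
by rewrite /Alie bilin_extUU.
Qed.

Lemma Agen_jacobi chi c p a m b n :
  Alie (Agen chi c p) (Abracket chi (Some (a, m)) (Some (b, n)))
  + Alie (Agen chi a m) (Abracket chi (Some (b, n)) (Some (c, p)))
  + Alie (Agen chi b n) (Abracket chi (Some (c, p)) (Some (a, m))) = 0.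
Proof.
pose x := chi (b *~ m - a *~ n).
pose y := chi (a *~ p - c *~ m).
pose z := chi (c *~ n - b *~ p).
have x0 : x != 0 := char_neq0 _ _.
have y0 : y != 0 := char_neq0 _ _.
have z0 : z != 0 := char_neq0 _ _.
have eN d e : chi (e - d) = (chi (d - e))^-1 by rewrite -(opprB d) charN.
have E1 := @Alie_Abracket chi c p a m b n x y z^-1 erefl erefl (eN _ _).
have E2 := @Alie_Abracket chi a m b n c p z x y^-1 erefl erefl (eN _ _).
have E3 := @Alie_Abracket chi b n c p a m y z x^-1 erefl erefl (eN _ _).
apply: etrans (f_equal2 +%R (f_equal2 +%R E1 E2) E3) _; clear E1 E2 E3.
have -> : b + c + a = a + b + c by rewrite addrC addrA.
have -> : c + a + b = a + b + c by rewrite -addrA addrC.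
have -> : n + p + m = m + n + p by rewrite addrC addrA.
have -> : p + m + n = m + n + p by rewrite -addrA addrC.
rewrite lcomb3 [X in X *: _ + _](_ : _ = 0); last by field; rewrite x0 y0 z0.
rewrite [X in _ + X *: _](_ : _ = 0) ?scale0r ?addr0 //.
case: (eqVneq (a + b + c) 0) => [s0|_]; last by rewrite !(mulr0, mul0r, addr0).
case: (eqVneq (m + n + p) 0) => [t0|_]; last by rewrite !(mulr0, addr0).
have cE : c = - (a + b) by apply/eqP; rewrite -addr_eq0 addrC s0.
have pE : p = - (m + n) by apply/eqP; rewrite -addr_eq0 addrC t0.
have -> : z = x.
  rewrite /z /x cE pE; congr (chi _).
  rewrite mulNrz mulrNz opprK mulrzDl mulrzDr opprD addrACA.
  by rewrite addNr addr0 addrC.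
have -> : y = x.
  rewrite /y /x cE pE; congr (chi _).
  rewrite mulNrz mulrNz opprK mulrzDl mulrzDr opprD addrACA.
  by rewrite addNr add0r addrC.
rewrite !mulr1 -!mulrDr; move: t0; rewrite pE rmorphN rmorphD /= => _.
by rewrite addrAC [X in _ * X](_ : _ = 0) ?mulr0 //; ring.
Qed.

Lemma Alie_jacobi chi u v w :
  Alie u (Alie v w) + Alie v (Alie w u) + Alie w (Alie u v) = 0 :> Ahat chi.
Proof.
have zero3 (x y z : Ahat chi) : x = 0 -> y = 0 -> z = 0 -> x + y + z = 0.
  by move=> -> -> ->; rewrite !addr0.
have lie0 (x y : Ahat chi) : y = 0 -> Alie x y = 0.
  by move=> ->; exact: Alie0r.
have A0l i : Abracket chi None i = 0 by [].
have A0r i : Abracket chi i None = 0 by case: i => [[]|].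
apply: (@bilin_ext_jacobi _ _ (Abracket chi)) => i j k.
case: i => [[c p]|]; last first.
  by apply: zero3; [exact: Alie_cl | exact: lie0 (A0r _) | exact: lie0 (A0l _)].
case: j => [[a m]|]; last first.
  by apply: zero3; [exact: lie0 (A0l _) | exact: Alie_cl | exact: lie0 (A0r _)].
case: k => [[b n]|]; last first.
  by apply: zero3; [exact: lie0 (A0r _) | exact: lie0 (A0l _) | exact: Alie_cl].
exact: Agen_jacobi.
Qed.

HB.instance Definition _ chi := Lmodule_isLie.Build K (Ahat chi)
  (@AlieDZl chi) (@AlieDZr chi) (@AliexxP chi) (@Alie_jacobi chi).

End Ahat.

Lemma lin2_congr (K : nzRingType) (V : lmodType K) (x x' y y' : K) (u w : V) :
  x = x' -> y = y' -> x *: u + y *: w = x' *: u + y' *: w.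
Proof. by move=> -> ->. Qed.

Section Dhat.
Variables (K : numFieldType) (S : zmodType) (chi : character S K).
Local Notation A := (Ahat chi).

Definition tauD_gen (x : option (S * int)) : A :=
  if x is Some (alpha, m)
  then - (chi (alpha *+ 2) *: Agen chi (- alpha) m) else Ac chi.

Definition tauD : A -> A := lin_ext tauD_gen.
Fact tauD_linear : linear tauD. Proof. exact: (lin_ext_linear tauD_gen). Qed.
HB.instance Definition _ := GRing.isLinear.Build K A A _ tauD tauD_linear.

Lemma tauD_c : tauD (Ac chi) = Ac chi. Proof. exact: lin_extU. Qed.

Lemma tauD_A alpha m :
  tauD (Agen chi alpha m) = - (chi (alpha *+ 2) *: Agen chi (- alpha) m).
Proof. exact: lin_extU. Qed.

Lemma Ahat_ind (P : A -> Prop) :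
  P 0 -> (forall c u v, P u -> P v -> P (c *: u + v)) -> P (Ac chi) ->
  (forall a m, P (Agen chi a m)) -> forall u, P u.
Proof.
move=> P0 PL Pc PA; apply: (@malg_lin_ind _ _ P P0 PL) => -[[a m]|].
  exact: PA.
exact: Pc.
Qed.

Lemma lie_Ac_l u : lie (Ac chi) u = 0 :> A. Proof. exact: Alie_cl. Qed.
Lemma lie_Ac_r u : lie u (Ac chi) = 0 :> A. Proof. exact: Alie_cr. Qed.

Lemma lie_Agen alpha m beta n :
  lie (Agen chi alpha m) (Agen chi beta n)
  = (chi (beta *~ m - alpha *~ n) - chi (alpha *~ n - beta *~ m))
          *: Agen chi (alpha + beta) (m + n)
        + (m%:~R * (alpha + beta == 0)%:R * (m + n == 0)%:R) *: Ac chi.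
Proof. exact: Alie_genl. Qed.

Lemma tauDK : involutive tauD.
Proof.
elim/Ahat_ind => [|c u v IH IH'||a m]; first by rewrite !linear0.
- by rewrite linearP /= linearP /= IH IH'.
- by rewrite !tauD_c.
rewrite tauD_A linearN linearZ /= tauD_A opprK scalerN opprK scalerA -charD.
by rewrite mulNrn subrr char0 scale1r.
Qed.

Lemma tauD_lie u v : tauD (lie u v) = lie (tauD u) (tauD v).
Proof.
elim/Ahat_ind: u => [|c u u' IH IH'||a m].
- by rewrite lie0l !linear0 lie0l.
- by rewrite lieDZl linearP /= IH IH' linearP /= lieDZl.
- by rewrite tauD_c !lie_Ac_l linear0.
elim/Ahat_ind: v => [|c u u' IH IH'||b n].
- by rewrite lie0r !linear0 lie0r.
- by rewrite lieDZr linearP /= IH IH' linearP /= lieDZr.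
- by rewrite tauD_c !lie_Ac_r linear0.
have tauE x y (u w : A) : tauD (x *: u + y *: w) = x *: tauD u + y *: tauD w.
  by rewrite linearP linearZ.
have NN x y (u w : A) : lie (- (x *: u)) (- (y *: w)) = (x * y) *: lie u w.
  by rewrite lieNl lieNr opprK lieZl lieZr scalerA.
rewrite (tauD_A a m) (tauD_A b n) NN.
apply: etrans (f_equal tauD (lie_Agen a m b n)) _; rewrite tauE tauD_A tauD_c.
apply: etrans _ (esym (f_equal _ (lie_Agen (- a) m (- b) n))).
rewrite scalerN scalerA -scaleNr scalerDr !scalerA -charD -mulrnDl.
rewrite -(opprD a b).
rewrite oppr_eq0.
apply: lin2_congr.

  rewrite !mulNrz !opprK [- (b *~ m) + _]addrC [- (a *~ n) + _]addrC.
  by ring.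
have [->|] := eqVneq (a + b) 0; last by rewrite !(mulr0, mul0r).
by rewrite mul0rn char0 mul1r.
Qed.

Definition Dpred : {pred A} := [pred u | tauD u == u].

Fact Dpred_submod : submod_closed Dpred.
Proof.
split=> [|c u v]; rewrite !inE ?linear0 // => /eqP hu /eqP hv.
by rewrite linearP /= hu hv.
Qed.
HB.instance Definition _ := GRing.isSubmodClosed.Build K A Dpred Dpred_submod.

Definition Dhat : Type := {u : A | Dpred u}.
HB.instance Definition _ := SubChoice.on Dhat.
HB.instance Definition _ := [SubChoice_isSubLmodule of Dhat by <:].

Fact Dhat_lie_closed (u v : Dhat) : Dpred (lie (val u) (val v)).
Proof.
rewrite /Dpred /= tauD_lie.
by have /eqP -> := valP u; have /eqP -> := valP v.
Qed.

Definition Dlie (u v : Dhat) : Dhat := Sub _ (Dhat_lie_closed u v).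

Fact DlieDZl c u v w : Dlie (c *: u + v) w = c *: Dlie u w + Dlie v w.
Proof. by apply: val_inj; rewrite /= lieDZl. Qed.
Fact DlieDZr c u v w : Dlie u (c *: v + w) = c *: Dlie u v + Dlie u w.
Proof. by apply: val_inj; rewrite /= lieDZr. Qed.
Fact Dliexx u : Dlie u u = 0.
Proof. by apply: val_inj; rewrite /= liexx. Qed.
Fact Dlie_jacobi u v w :
  Dlie u (Dlie v w) + Dlie v (Dlie w u) + Dlie w (Dlie u v) = 0.
Proof. by apply: val_inj; rewrite /= lie_jacobi. Qed.

HB.instance Definition _ := Lmodule_isLie.Build K Dhat
  DlieDZl DlieDZr Dliexx Dlie_jacobi.

Fact Dc_subproof : Dpred (Ac chi).
Proof. by rewrite /Dpred /= tauD_c. Qed.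
Definition Dc : Dhat := Sub (Ac chi) Dc_subproof.

Fact Dgen_subproof alpha m : Dpred (Agen chi alpha m + tauD (Agen chi alpha m)).
Proof. by rewrite /Dpred /= linearD /= tauDK addrC. Qed.
Definition Dgen (alpha : S) (m : int) : Dhat :=
  Sub (Agen chi alpha m + tauD (Agen chi alpha m)) (Dgen_subproof alpha m).

End Dhat.

Lemma commutator_jacobi (K : comNzRingType) (I : choiceType)
    (p1 p2 p3 p4 p5 p6 : {malg K[I]}) :
  (p1 - p2 - (p3 - p4)) + (p3 - p5 - (p6 - p2)) + (p6 - p4 - (p1 - p5)) = 0.
Proof. by apply/malgP => k; rewrite !(mcoeffD, mcoeffN, mcoeff0); ring. Qed.

Section LS.
Variables (K : numFieldType) (S : zmodType).

Definition LS : Type := {malg K[(S * S)%type]}.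
HB.instance Definition _ := GRing.Lmodule.on LS.

Definition Lgen (alpha beta : S) : LS := << (alpha, beta) >>.

Definition Lmul_gen (x y : S * S) : LS :=
  (x.1 + y.1 == x.2 - y.2)%:R *: Lgen (x.1 + y.1) (x.1 + y.2).

Definition Lmul : LS -> LS -> LS := bilin_ext Lmul_gen.

Definition Lform_gen (x y : S * S) : K^o :=
  (x.1 + y.1 == 0)%:R * (x.2 == y.2)%:R.

Definition Lform : LS -> LS -> K := bilin_ext Lform_gen.

Lemma LS_ind (P : LS -> Prop) :
  P 0 -> (forall c u v, P u -> P v -> P (c *: u + v)) ->
  (forall a b, P (Lgen a b)) -> forall u, P u.
Proof.
move=> P0 PL PU; apply: (@malg_lin_ind _ _ P P0 PL) => -[a b]; exact: PU.
Qed.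

Lemma LmulDZl c u v w : Lmul (c *: u + v) w = c *: Lmul u w + Lmul v w.
Proof. exact: (bilin_extl Lmul_gen). Qed.
Lemma LmulDZr c u v w : Lmul u (c *: v + w) = c *: Lmul u v + Lmul u w.
Proof. exact: (bilin_extr Lmul_gen). Qed.
Lemma Lmul0l u : Lmul 0 u = 0.
Proof. exact: (bilin_ext0l Lmul_gen). Qed.
Lemma Lmul0r u : Lmul u 0 = 0.
Proof. exact: (linear0 (bilin_ext Lmul_gen u)). Qed.
Lemma LmulZl c u v : Lmul (c *: u) v = c *: Lmul u v.
Proof. by have := LmulDZl c u 0 v; rewrite Lmul0l !addr0. Qed.
Lemma LmulZr c u v : Lmul u (c *: v) = c *: Lmul u v.
Proof. by have := LmulDZr c u v 0; rewrite Lmul0r !addr0. Qed.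
Lemma LmulDl u v w : Lmul (u + v) w = Lmul u w + Lmul v w.
Proof. by have := LmulDZl 1 u v w; rewrite !scale1r. Qed.
Lemma LmulDr u v w : Lmul u (v + w) = Lmul u v + Lmul u w.
Proof. by have := LmulDZr 1 u v w; rewrite !scale1r. Qed.
Lemma LmulNl u v : Lmul (- u) v = - Lmul u v.
Proof. by rewrite -scaleN1r LmulZl scaleN1r. Qed.
Lemma LmulNr u v : Lmul u (- v) = - Lmul u v.
Proof. by rewrite -scaleN1r LmulZr scaleN1r. Qed.

Lemma LmulE a b m n :
  Lmul (Lgen a b) (Lgen m n) = (a + m == b - n)%:R *: Lgen (a + m) (a + n).
Proof. exact: bilin_extUU. Qed.

Lemma LmulA u v w : Lmul u (Lmul v w) = Lmul (Lmul u v) w.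
Proof.
elim/LS_ind: u => [|c u u' IH IH'|a b]; first by rewrite !Lmul0l.
  by rewrite !LmulDZl IH IH'.
elim/LS_ind: v => [|c v v' IH IH'|m n]; first by rewrite Lmul0l Lmul0r Lmul0l.
  by rewrite LmulDZl !LmulDZr LmulDZl IH IH'.
elim/LS_ind: w => [|c w w' IH IH'|r s]; first by rewrite !Lmul0r.
  by rewrite !LmulDZr IH IH'.
rewrite (LmulE m n r s) (LmulE a b m n) LmulZr LmulZl.
rewrite (LmulE a b (m + r)) (LmulE (a + m) (a + n)) !scalerA addrA.
rewrite (addrA a m s); congr (_ *: _); rewrite -!natrM !mulnb; congr (_%:R).
congr nat_of_bool; apply/idP/idP => /andP[/eqP h /eqP h'].
  have nE : n = m + r + s by rewrite h addrNK.
  have bE : b = a + m + r + (m + s) by rewrite h' addrNK.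
  rewrite nE bE; apply/andP; split; apply/eqP; last by rewrite !addrA addrK.
  by rewrite -(addrA (a + m)) (addrCA r m s) (addrA m r s) addrK.
have bE : b = a + m + n by rewrite h addrNK.
have nE : n = m + r + s.
  apply: (addrI a); apply: (addIr (- s)).
  by rewrite -h' addrA addrK addrA.
apply/andP; split; apply/eqP; first by rewrite nE addrK.
by rewrite bE nE -!addrA; congr (_ + (_ + _)); 
by rewrite (addrCA m r) (addrA m s) subrr addr0.
Qed.

Definition Llie (u v : LS) : LS := Lmul u v - Lmul v u.

Fact LlieDZl c u v w : Llie (c *: u + v) w = c *: Llie u w + Llie v w.
Proof. by rewrite /Llie LmulDZl LmulDZr opprD addrACA scalerBr. Qed.
Fact LlieDZr c u v w : Llie u (c *: v + w) = c *: Llie u v + Llie u w.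
Proof. by rewrite /Llie LmulDZl LmulDZr opprD addrACA scalerBr. Qed.
Fact Lliexx u : Llie u u = 0. Proof. exact: subrr. Qed.
Fact Llie_jacobi u v w :
  Llie u (Llie v w) + Llie v (Llie w u) + Llie w (Llie u v) = 0.
Proof.
have E x y z : Llie x (Llie y z) = (Lmul (Lmul x y) z - Lmul (Lmul x z) y)
    - (Lmul (Lmul y z) x - Lmul (Lmul z y) x).
  by rewrite /Llie LmulDl LmulDr LmulNl LmulNr !LmulA.
by rewrite !E; exact: commutator_jacobi.
Qed.

HB.instance Definition _ := Lmodule_isLie.Build K LS
  LlieDZl LlieDZr Lliexx Llie_jacobi.

End LS.

Arguments Lgen {K S} alpha beta.

Section Affine.
Variables (K : nzRingType) (g : lmodType K).

(* g (x) C[t, t^-1]: the coefficient at [m : int] is the coefficient of t^m. *)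
Definition loop : Type := {malg g[int]}.
HB.instance Definition _ := GRing.Zmodule.on loop.

Definition loop_scale (c : K) (u : loop) : loop :=
  [malg m in msupp u => c *: u@_m].

Lemma loop_scaleE c (u : loop) m : (loop_scale c u)@_m = c *: u@_m.
Proof. by rewrite mcoeffE; case: msuppP; rewrite ?scaler0. Qed.

Fact loop_scaleA c d u : loop_scale c (loop_scale d u) = loop_scale (c * d) u.
Proof. by apply/malgP => k; rewrite !loop_scaleE scalerA. Qed.
Fact loop_scale1 : left_id 1 loop_scale.
Proof. by move=> u; apply/malgP => k; rewrite loop_scaleE scale1r. Qed.
Fact loop_scaleDr : right_distributive loop_scale +%R.
Proof.
move=> c u v; apply/malgP => k.
by rewrite loop_scaleE !mcoeffD !loop_scaleE scalerDr.
Qed.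
Fact loop_scaleDl u : {morph loop_scale^~ u : c d / c + d}.
Proof.
move=> c d; apply/malgP => k.
by rewrite mcoeffD !loop_scaleE scalerDl.
Qed.
HB.instance Definition _ := GRing.Zmodule_isLmodule.Build K loop
  loop_scaleA loop_scale1 loop_scaleDr loop_scaleDl.

Definition affine : Type := (loop * K^o)%type.
HB.instance Definition _ := GRing.Lmodule.on affine.

Definition tens (a : g) (m : int) : affine := (<< a *g m >> : loop, 0).
Definition aff_k : affine := (0, 1).

Lemma loop_coeffZ c (u : loop) m : (c *: u)@_m = c *: u@_m.
Proof. exact: loop_scaleE. Qed.

Lemma tens_linear m : linear (tens ^~ m).
Proof.
move=> c a b; congr (_, _) => /=; last by rewrite scaler0 addr0.
by apply/malgP => k; rewrite mcoeffD loop_coeffZ !mcoeffU mulrnDl scalerMnr.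
Qed.

Lemma tensDZ c a b m : tens (c *: a + b) m = c *: tens a m + tens b m.
Proof. exact: tens_linear. Qed.
Lemma tens0 m : tens 0 m = 0.
Proof. by congr (_, _); apply: monalgU0. Qed.
Lemma tensZ c a m : tens (c *: a) m = c *: tens a m.
Proof. by rewrite -[c *: a]addr0 tensDZ tens0 addr0. Qed.
Lemma tensD a b m : tens (a + b) m = tens a m + tens b m.
Proof. by rewrite -[a]scale1r tensDZ !scale1r. Qed.

Lemma tensN a m : tens (- a) m = - tens a m.
Proof. by rewrite -scaleN1r tensZ scaleN1r. Qed.

Lemma affine_ind (P : affine -> Prop) :
  (forall u v, P u -> P v -> P (u + v)) ->
  (forall c, P (c *: aff_k)) -> (forall a m, P (tens a m)) -> forall u, P u.
Proof.
move=> PD Pk PU [u c].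
have -> : (u, c) = (u, 0) + c *: aff_k :> affine.
  congr (_, _) => /=; first by rewrite scaler0 addr0.
  by rewrite add0r; apply: esym (mulr1 c).
apply: (PD) => //; elim/malg_add_ind: u => [|u v IH IH'|a i].
- by have := Pk 0; rewrite scale0r.
- have -> : (u + v, 0) = (u, 0) + (v, 0) :> affine by congr (_, _); rewrite /= addr0.
  exact: PD.
exact: PU.
Qed.

End Affine.

Arguments tens {K g} a m.
Arguments aff_k {K g}.

(* [cov_lie_fin] and [cov_form_fin] make the sums over G in [cov_tens] below finite.
   \sum_(x \in [set: G]) is the sum over the finite support of the summand. *)
Record covariant_data (K : numFieldType) (g : lieType K) (G : groupType) :=
  CovariantData {
  cov_form : g -> g -> K;
  cov_formDZl : forall c a b d,
    cov_form (c *: a + b) d = c * cov_form a d + cov_form b d;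
  cov_formC : forall a b, cov_form a b = cov_form b a;
  cov_form_inv : forall a b d, cov_form (lie a b) d = cov_form a (lie b d);
  cov_act : G -> g -> g;
  cov_actDZ : forall x c a b,
    cov_act x (c *: a + b) = c *: cov_act x a + cov_act x b;
  cov_act1 : forall a, cov_act 1%g a = a;
  cov_actM : forall x y a, cov_act (x * y)%g a = cov_act x (cov_act y a);
  cov_act_lie : forall x a b,
    cov_act x (lie a b) = lie (cov_act x a) (cov_act x b);
  cov_act_form : forall x a b,
    cov_form (cov_act x a) (cov_act x b) = cov_form a b;
  cov_lie_fin : forall a b, finite_set [set x | lie (cov_act x a) b <> 0];
  cov_form_fin : forall a b, finite_set [set x | cov_form (cov_act x a) b <> 0];
  cov_char : G -> K;
  cov_char1 : cov_char 1%g = 1;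
  cov_charM : forall x y, cov_char (x * y)%g = cov_char x * cov_char y
}.

Section FiniteSums.
Variables (T : choiceType).

Definition fin_supp (V : zmodType) (F : T -> V) := finite_set [set x | F x <> 0].

Lemma fsumE (V : zmodType) (F : T -> V) (X : {fset T}) :
  (forall x, F x <> 0 -> x \in X) ->
  \sum_(x \in [set: T]) F x = \sum_(x <- X) F x.
Proof.
move=> h; apply: fsbigTE => x xX; apply/eqP; apply: contraNT xX => /eqP.
exact: h.
Qed.

Lemma fin_suppP (V : zmodType) (F : T -> V) :
  fin_supp F <-> exists X : {fset T}, forall x, F x <> 0 -> x \in X.
Proof.
split=> [/finite_fsetP[X XE]|[X h]].
  exists X => x Fx; suff : [set` X] x by [].
  by rewrite -XE.
by apply: (sub_finite_set (B := [set` X])) => // x /= /h.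
Qed.

Lemma fsumD (V : zmodType) (F F' : T -> V) : fin_supp F -> fin_supp F' ->
  \sum_(x \in [set: T]) (F x + F' x) =
  \sum_(x \in [set: T]) F x + \sum_(x \in [set: T]) F' x.
Proof.
move=> /fin_suppP[X hX] /fin_suppP[Y hY].
have hX' x : F x <> 0 -> x \in (X `|` Y)%fset.
  by move=> /hX xX; rewrite in_fsetU xX.
have hY' x : F' x <> 0 -> x \in (X `|` Y)%fset.
  by move=> /hY xY; rewrite in_fsetU xY orbT.
rewrite (fsumE hX') (fsumE hY') (fsumE (X := (X `|` Y)%fset)) ?big_split //.
move=> x h; have [Fx|/eqP/hX' //] := eqVneq (F x) 0.
by apply: hY'; move: h; rewrite Fx add0r.
Qed.

Lemma fsum_morph (V W : zmodType) (h : V -> W) (F : T -> V) :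
  h 0 = 0 -> {morph h : x y / x + y} -> fin_supp F ->
  h (\sum_(x \in [set: T]) F x) = \sum_(x \in [set: T]) h (F x).
Proof.
move=> h0 hD /fin_suppP[X hX].
rewrite (fsumE hX) (fsumE (X := X)) ?(big_morph h hD h0) // => x hx.
by apply: hX => F0; apply: hx; rewrite F0.
Qed.

Lemma fin_supp_morph (V W : zmodType) (h : T -> V -> W) (F : T -> V) :
  (forall x, h x 0 = 0) -> fin_supp F -> fin_supp (fun x => h x (F x)).
Proof.
move=> h0; apply: sub_finite_set => x /= hx F0; apply: hx.
by rewrite F0 h0.
Qed.

Lemma fin_suppD (V : zmodType) (F F' : T -> V) : fin_supp F -> fin_supp F' ->
  fin_supp (fun x => F x + F' x).
Proof.
move=> fF fF'; apply: sub_finite_set (_ : finite_set ([set x | F x <> 0] `|`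
  [set x | F' x <> 0])); last by rewrite finite_setU.
move=> x /= h; have [Fx|/eqP] := eqVneq (F x) 0; last by left.
by right => F'x; apply: h; rewrite Fx F'x addr0.
Qed.

Lemma fsum_reindex (V : zmodType) (F : T -> V) (h : T -> T) : bijective h ->
  \sum_(x \in [set: T]) F x = \sum_(x \in [set: T]) F (h x).
Proof. exact: reindex_fsbigT. Qed.

Definition fin_supp2 (V : zmodType) (F : T -> T -> V) :=
  exists X Y : {fset T}, forall x y, F x y <> 0 -> x \in X /\ y \in Y.

Lemma fsum2E (V : zmodType) (F : T -> T -> V) (X Y : {fset T}) :
  (forall x y, F x y <> 0 -> x \in X /\ y \in Y) ->
  \sum_(x \in [set: T]) \sum_(y \in [set: T]) F x y =
  \sum_(x <- X) \sum_(y <- Y) F x y.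
Proof.
move=> h.
have hin x : \sum_(y \in [set: T]) F x y = \sum_(y <- Y) F x y.
  by apply: fsumE => y /h[].
under eq_fsbigr do rewrite hin.
apply: fsumE => x; apply: contra_notT => xX; apply: big1 => y _.
by apply: contra_notP (negP xX) => /h[].
Qed.

Lemma fsum_exchange (V : zmodType) (F : T -> T -> V) : fin_supp2 F ->
  \sum_(x \in [set: T]) \sum_(y \in [set: T]) F x y =
  \sum_(y \in [set: T]) \sum_(x \in [set: T]) F x y.
Proof.
move=> [X [Y h]]; rewrite (fsum2E h) (fsum2E (X := Y) (Y := X)).
  exact: exchange_big.
by move=> y x /h[].
Qed.

Lemma fsum2D (V : zmodType) (F F' : T -> T -> V) : fin_supp2 F -> fin_supp2 F' ->
  \sum_(x \in [set: T]) \sum_(y \in [set: T]) (F x y + F' x y) =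
  \sum_(x \in [set: T]) \sum_(y \in [set: T]) F x y +
  \sum_(x \in [set: T]) \sum_(y \in [set: T]) F' x y.
Proof.
move=> [X [Y h]] [X' [Y' h']].
have hU x y : F x y <> 0 -> x \in (X `|` X')%fset /\ y \in (Y `|` Y')%fset.
  by move=> /h[xX yY]; rewrite !in_fsetU xX yY.
have hU' x y : F' x y <> 0 -> x \in (X `|` X')%fset /\ y \in (Y `|` Y')%fset.
  by move=> /h'[xX yY]; rewrite !in_fsetU xX yY !orbT.
have hS x y : F x y + F' x y <> 0 ->
    x \in (X `|` X')%fset /\ y \in (Y `|` Y')%fset.
  move=> e; have [Fx|/eqP/hU //] := eqVneq (F x y) 0.
  by apply: hU'; move: e; rewrite Fx add0r.
rewrite (fsum2E hU) (fsum2E hU') (fsum2E hS) -big_split /=.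
by apply: eq_bigr => x _; rewrite big_split.
Qed.

Lemma fin_supp2_iter (V W : zmodType) (F : T -> T -> V) (H : T -> W) :
  fin_supp H -> (forall x y, H x = 0 -> F x y = 0) ->
  (forall x, fin_supp (F x)) -> fin_supp2 F.
Proof.
move=> /fin_suppP[X hX] hF fF.
pose Y x := projT1 (cid ((fin_suppP (F x)).1 (fF x))).
have hY x y : F x y <> 0 -> y \in Y x by rewrite /Y; case: cid => X' hX' /= /hX'.
exists X, (\bigcup_(x <- X) Y x)%fset => x y h.
have xX : x \in X by apply: hX => Hx; apply: h; apply: hF.
split=> //; apply/bigfcupP; exists x; first by rewrite xX.
exact: hY.
Qed.

Lemma fin_supp2_swap (V : zmodType) (F : T -> T -> V) :
  fin_supp2 (fun x y => F y x) -> fin_supp2 F.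
Proof. by move=> [X [Y h]]; exists Y, X => x y /h[]. Qed.

Lemma fin_supp2_sub (V : zmodType) (F F' F'' : T -> T -> V) :
  fin_supp2 F -> fin_supp2 F' -> (forall x y, F'' x y = F x y - F' x y) ->
  fin_supp2 F''.
Proof.
move=> [X [Y h]] [X' [Y' h']] E.
exists (X `|` X')%fset, (Y `|` Y')%fset => x y; rewrite E !in_fsetU => e.
have [Fx|/eqP/h[-> ->] //] := eqVneq (F x y) 0.
have /h'[-> ->] : F' x y <> 0; last by rewrite !orbT.
by move=> F'x; apply: e; rewrite Fx F'x subr0.
Qed.

End FiniteSums.

Section Span.
Variables (K : nzRingType) (V : lmodType K) (X : set V).

Definition lspan : set V :=
  [set v | exists s : seq (K * V),
    (forall p, p \in s -> X p.2) /\ v = \sum_(p <- s) p.1 *: p.2].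

Lemma lspan_ind (P : V -> Prop) : P 0 ->
  (forall c w v, X w -> P v -> P (c *: w + v)) -> forall v, lspan v -> P v.
Proof.
move=> P0 PS v [s [sX ->]]; elim: s sX => [|p s IH] sX; first by rewrite big_nil.
rewrite big_cons; apply: PS; first by apply: sX; rewrite mem_head.
by apply: IH => q qs; apply: sX; rewrite inE qs orbT.
Qed.

Lemma lspan0 : lspan 0.
Proof. by exists [::]; rewrite big_nil; split. Qed.

Lemma lspan_mem v : X v -> lspan v.
Proof.
move=> Xv; exists [:: (1, v)]; rewrite big_seq1 scale1r; split=> // p.
by rewrite inE => /eqP ->.
Qed.

Lemma lspanDZ c u v : lspan u -> lspan v -> lspan (c *: u + v).
Proof.
move=> [s [sX ->]] [t [tX ->]].
exists ([seq (c * p.1, p.2) | p <- s] ++ t); split=> [p|].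
  rewrite mem_cat => /orP[/mapP[q qs ->]|]; last exact: tX.
  exact: sX qs.
rewrite big_cat big_map /= scaler_sumr; congr (_ + _).
by apply: eq_bigr => p _; rewrite scalerA.
Qed.

End Span.

Section Covariant.
Variables (K : numFieldType) (g : lieType K) (G : groupType).
Variable d : covariant_data g G.

Local Notation form := (cov_form d).
Local Notation act := (cov_act d).
Local Notation phi := (cov_char d).
Local Notation V := (affine g).

Definition cov_term (x : G) (a : g) (m : int) (b : g) (n : int) : V :=
  phi x ^ m *: (tens (lie (act x a) b) (m + n)
    + (m%:~R * form (act x a) b * (m + n == 0)%:R) *: aff_k).

Definition cov_tens (a : g) (m : int) (b : g) (n : int) : V :=
  \sum_(x \in [set: G]) cov_term x a m b n.

(* [u.1@_m] is the coefficient of t^m in u; k, the second component, is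
   bracketed to 0 on both sides. *)
Definition cov_bracket (u v : V) : V :=
  \sum_(m <- msupp u.1) \sum_(n <- msupp v.1) cov_tens u.1@_m m v.1@_n n.

Definition cov_gens : set V :=
  [set z | exists x a m, z = phi x ^ m *: tens (act x a) m - tens a m].

Definition cov_ideal : {pred V} := [pred v | `[< lspan cov_gens v >]].

Lemma formDZr c a b e : form e (c *: a + b) = c * form e a + form e b.
Proof. by rewrite !(cov_formC d e) cov_formDZl. Qed.
Lemma form0l b : form 0 b = 0.
Proof.
apply: (addrI (form 0 b)); rewrite addr0.
by have := cov_formDZl d 1 0 0 b; rewrite scaler0 addr0 mul1r.
Qed.
Lemma form0r b : form b 0 = 0. Proof. by rewrite cov_formC form0l. Qed.
Lemma act0 x : act x 0 = 0.
Proof.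
apply: (addrI (act x 0)); rewrite addr0.
by have := cov_actDZ d x 1 0 0; rewrite scaler0 addr0 scale1r.
Qed.
Lemma actZ x c a : act x (c *: a) = c *: act x a.
Proof. by rewrite -[c *: a]addr0 cov_actDZ act0 addr0. Qed.
Lemma actK x a : act x (act x^-1%g a) = a.
Proof. by rewrite -cov_actM mulgV cov_act1. Qed.
Lemma phi_neq0 x : phi x != 0.
Proof.
apply/eqP => h; have := cov_char1 d; rewrite -(mulgV x) cov_charM h mul0r.
by move/eqP; rewrite eq_sym oner_eq0.
Qed.

Lemma cov_term_fin a m b n : fin_supp (fun x => cov_term x a m b n).
Proof.
have f1 := cov_lie_fin d a b; have f2 := cov_form_fin d a b.
apply: sub_finite_set (_ : finite_set ([set x | lie (act x a) b <> 0] `|`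
  [set x | form (act x a) b <> 0])); last by rewrite finite_setU.
move=> x /= h; have [e|/eqP] := eqVneq (lie (act x a) b) 0; last by left.
right => e'; apply: h.
by rewrite /cov_term e e' mulr0 mul0r scale0r tens0 addr0 scaler0.
Qed.

Let scaleC (c e : K) (v : V) : c *: (e *: v) = e *: (c *: v).
Proof. by rewrite !scalerA mulrC. Qed.

Lemma cov_termDZl x c a a' m b n : cov_term x (c *: a + a') m b n
  = c *: cov_term x a m b n + cov_term x a' m b n.
Proof.
rewrite /cov_term cov_actDZ lieDZl tensDZ cov_formDZl.
rewrite (scaleC c) -scalerDr; congr (_ *: _).
rewrite mulrDr mulrDl scalerDl scalerDr addrACA; congr (_ + _ + _).
by rewrite scalerA; congr (_ *: _); ring.
Qed.

Lemma cov_termDZr x c a m b b' n : cov_term x a m (c *: b + b') n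
  = c *: cov_term x a m b n + cov_term x a m b' n.
Proof.
rewrite /cov_term lieDZr tensDZ formDZr.
rewrite (scaleC c) -scalerDr; congr (_ *: _).
rewrite mulrDr mulrDl scalerDl scalerDr addrACA; congr (_ + _ + _).
by rewrite scalerA; congr (_ *: _); ring.
Qed.

Let finZ c (F : G -> V) : fin_supp F -> fin_supp (fun x => c *: F x).
Proof.
exact: (@fin_supp_morph G V V (fun=> *:%R c) F (fun=> scaler0 V c)).
Qed.

Let sumZ c (F : G -> V) : fin_supp F ->
  c *: \sum_(x \in [set: G]) F x = \sum_(x \in [set: G]) c *: F x.
Proof. exact: (@fsum_morph G V V ( *:%R c) F (scaler0 V c) (scalerDr c)). Qed.

Lemma cov_tensDZl c a a' m b n :
  cov_tens (c *: a + a') m b n = c *: cov_tens a m b n + cov_tens a' m b n.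
Proof.
rewrite /cov_tens sumZ; last exact: cov_term_fin.
rewrite -fsumD; [|exact: finZ (cov_term_fin _ _ _ _)|exact: cov_term_fin].
by apply: eq_fsbigr => x _; rewrite cov_termDZl.
Qed.

Lemma cov_tensDZr c a m b b' n :
  cov_tens a m (c *: b + b') n = c *: cov_tens a m b n + cov_tens a m b' n.
Proof.
rewrite /cov_tens sumZ; last exact: cov_term_fin.
rewrite -fsumD; [|exact: finZ (cov_term_fin _ _ _ _)|exact: cov_term_fin].
by apply: eq_fsbigr => x _; rewrite cov_termDZr.
Qed.

Let B (m : int) (a : g) (n : int) (b : g) := cov_tens a m b n.
Let BDl m a a' n b : B m (a + a') n b = B m a n b + B m a' n b.
Proof. by have := cov_tensDZl 1 a a' m b n; rewrite !scale1r. Qed.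
Let BDr m a n b b' : B m a n (b + b') = B m a n b + B m a n b'.
Proof. by have := cov_tensDZr 1 a m b b' n; rewrite !scale1r. Qed.
Let brE u v : cov_bracket u v = ext2 B u.1 v.1. Proof. by []. Qed.

Lemma cov_bracketDl u u' v :
  cov_bracket (u + u') v = cov_bracket u v + cov_bracket u' v.
Proof. by rewrite !brE; apply: ext2Dl. Qed.
Lemma cov_bracketDr u v v' :
  cov_bracket u (v + v') = cov_bracket u v + cov_bracket u v'.
Proof. by rewrite !brE; apply: ext2Dr. Qed.
Lemma cov_bracket0l v : cov_bracket 0 v = 0.
Proof. by rewrite brE; apply: ext20l. Qed.
Lemma cov_bracket0r v : cov_bracket v 0 = 0.
Proof. by rewrite brE; apply: ext20r. Qed.
Lemma cov_bracketkl c v : cov_bracket (c *: aff_k) v = 0.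
Proof. by rewrite brE /= scaler0; apply: ext20l. Qed.
Lemma cov_bracketkr c v : cov_bracket v (c *: aff_k) = 0.
Proof. by rewrite brE /= scaler0; apply: ext20r. Qed.
Lemma cov_bracketUU a m b n :
  cov_bracket (tens a m) (tens b n) = cov_tens a m b n.
Proof. by rewrite brE; apply: ext2UU. Qed.

Let cov_tens0l m b n : cov_tens 0 m b n = 0.
Proof. by apply: (addrI (B m 0 n b)); rewrite -BDl !addr0. Qed.
Let cov_tens0r a m n : cov_tens a m 0 n = 0.
Proof. by apply: (addrI (B m a n 0)); rewrite -BDr !addr0. Qed.

Lemma cov_bracketZl c u v : cov_bracket (c *: u) v = c *: cov_bracket u v.
Proof.
elim/affine_ind: u => [u u' IH IH'|e|a m].
- by rewrite scalerDr !cov_bracketDl IH IH' scalerDr.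
- by rewrite scalerA !cov_bracketkl scaler0.
elim/affine_ind: v => [u u' IH IH'|e|b n].
- by rewrite !cov_bracketDr IH IH' scalerDr.
- by rewrite !cov_bracketkr scaler0.
rewrite -tensZ !cov_bracketUU -[c *: a]addr0 cov_tensDZl.
by rewrite cov_tens0l addr0.
Qed.

Lemma cov_bracketZr c u v : cov_bracket u (c *: v) = c *: cov_bracket u v.
Proof.
elim/affine_ind: u => [u u' IH IH'|e|a m].
- by rewrite !cov_bracketDl IH IH' scalerDr.
- by rewrite !cov_bracketkl scaler0.
elim/affine_ind: v => [u u' IH IH'|e|b n].
- by rewrite scalerDr !cov_bracketDr IH IH' scalerDr.
- by rewrite scalerA !cov_bracketkr scaler0.
rewrite -tensZ !cov_bracketUU -[c *: b]addr0 cov_tensDZr.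
by rewrite cov_tens0r addr0.
Qed.

Lemma cov_bracketNl u v : cov_bracket (- u) v = - cov_bracket u v.
Proof. by rewrite -scaleN1r cov_bracketZl scaleN1r. Qed.
Lemma cov_bracketNr u v : cov_bracket u (- v) = - cov_bracket u v.
Proof. by rewrite -scaleN1r cov_bracketZr scaleN1r. Qed.

Lemma cov_idealP v : reflect (lspan cov_gens v) (v \in cov_ideal).
Proof. exact: asboolP. Qed.

Fact cov_ideal_submod : submod_closed cov_ideal.
Proof.
split=> [|c u v]; first exact/cov_idealP/lspan0.
by move=> /cov_idealP hu /cov_idealP hv; apply/cov_idealP/lspanDZ.
Qed.
HB.instance Definition _ :=
  GRing.isSubmodClosed.Build K V cov_ideal cov_ideal_submod.

Lemma cov_gen_ideal x a m :
  phi x ^ m *: tens (act x a) m - tens a m \in cov_ideal.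
Proof. by apply/cov_idealP/lspan_mem; exists x, a, m. Qed.

(* Each generator of the ideal brackets to 0 on the left. *)
Lemma cov_gen_bracket x a m v :
  cov_bracket (phi x ^ m *: tens (act x a) m - tens a m) v = 0.
Proof.
elim/affine_ind: v => [u u' IH IH'|e|b n].
- by rewrite cov_bracketDr IH IH' addr0.
- exact: cov_bracketkr.
rewrite cov_bracketDl cov_bracketNl cov_bracketZl !cov_bracketUU.
apply/eqP; rewrite subr_eq0; apply/eqP.
rewrite /cov_tens sumZ; last exact: cov_term_fin.
rewrite [RHS](@fsum_reindex _ _ _ (fun y => (y * x)%g)); last first.
  by exists (fun y => (y * x^-1)%g) => y; rewrite ?mulgK ?mulgVK.
apply: eq_fsbigr => y _; rewrite /cov_term cov_actM cov_charM scalerA.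
by rewrite expfzMl mulrC.
Qed.

Lemma cov_ideal_sum (F : G -> V) : (forall x, F x \in cov_ideal) ->
  \sum_(x \in [set: G]) F x \in cov_ideal.
Proof. by move=> h; apply: rpred_sum => x _. Qed.

Lemma cov_bracketC u v : cov_bracket u v + cov_bracket v u \in cov_ideal.
Proof.
elim/affine_ind: u => [u u' IH IH'|e|a m].
- by rewrite cov_bracketDl cov_bracketDr addrACA; apply: rpredD.
- by rewrite cov_bracketkl cov_bracketkr addr0 rpred0.
elim/affine_ind: v => [u u' IH IH'|e|b n].
- by rewrite cov_bracketDl cov_bracketDr addrACA; apply: rpredD.
- by rewrite cov_bracketkl cov_bracketkr addr0 rpred0.
rewrite !cov_bracketUU {2}/cov_tens (@fsum_reindex _ _ _ (fun x => x^-1%g));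
  last by exists (fun x : G => x^-1%g) => x; rewrite invgK.
have fin' : fin_supp (fun x : G => cov_term x^-1%g b n a m).
  have /fin_suppP[X hX] := cov_term_fin b n a m.
  apply/fin_suppP; exists [fset (x^-1)%g | x in X]%fset => x /hX h.
  by apply/imfsetP; exists (x^-1)%g => //; rewrite invgK.
rewrite -(fsumD (cov_term_fin a m b n) fin').
apply: cov_ideal_sum => x; rewrite /cov_term.
have -> : lie (act x^-1%g b) a = - act x^-1%g (lie (act x a) b).
  by rewrite cov_act_lie -cov_actM mulVg cov_act1 lieC.
have -> : form (act x^-1%g b) a = form (act x a) b.
  by rewrite -(cov_act_form d x) actK cov_formC.
have pV : phi x^-1%g = (phi x)^-1.
  apply: (mulfI (phi_neq0 x)); rewrite -cov_charM mulgV cov_char1.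
  by rewrite mulfV ?phi_neq0.
rewrite pV; set L := lie _ b; set f := form _ b; rewrite (addrC n m).
have E : cov_term x a m b n = cov_term x a m b n by [].
have hK : phi x ^ m *: ((m%:~R * f * (m + n == 0)%:R) *: aff_k)
    + (phi x)^-1 ^ n *: ((n%:~R * f * (m + n == 0)%:R) *: aff_k) = 0 :> V.
  have [mn|_] := eqVneq (m + n) 0; last by rewrite !mulr0 !scale0r !scaler0 addr0.
  have -> : n = - m by apply/eqP; rewrite -addr_eq0 addrC mn.
  rewrite exprz_inv opprK -scalerDr -scalerDl rmorphN /=.
  by rewrite !mulNr addrN scale0r scaler0.
rewrite !scalerDr addrACA hK addr0.
have h : - phi x ^ m *: (phi x^-1%g ^ (m + n) *: tens (act x^-1%g L) (m + n)
    - tens L (m + n)) \in cov_ideal by apply: rpredZ; apply: cov_gen_ideal.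
apply: etrans (f_equal (fun z => z \in cov_ideal) _) h.
rewrite scalerBr !scaleNr opprK addrC pV; congr (_ + _).
rewrite tensN scalerN scalerA; congr (- (_ *: _)).
rewrite expfzDr ?invr_eq0 ?phi_neq0 // mulrA !exprz_inv.
by rewrite -expfzDr ?phi_neq0 // subrr expr0z mul1r.
Qed.

Lemma cov_bracket_leibniz u v w :
  cov_bracket u (cov_bracket v w) =
  cov_bracket (cov_bracket u v) w + cov_bracket v (cov_bracket u w).
Proof.
have D x y x' y' : x + x' + (y + y') = (x + y) + (x' + y') :> V.
  exact: addrACA.
elim/affine_ind: u => [u u' IH IH'|e|a m].
- by rewrite !(cov_bracketDl, cov_bracketDr) IH IH' D.
- by rewrite !cov_bracketkl cov_bracket0l cov_bracket0r addr0.
elim/affine_ind: v => [v v' IH IH'|e|b n].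
- by rewrite !(cov_bracketDl, cov_bracketDr) IH IH' D.
- by rewrite !cov_bracketkl cov_bracketkr cov_bracket0l cov_bracket0r addr0.
elim/affine_ind: w => [w w' IH IH'|e|c p].
- by rewrite !(cov_bracketDl, cov_bracketDr) IH IH' D.
- by rewrite !cov_bracketkr !cov_bracket0r addr0.
have brR a' m' b' n' c' p' :
    cov_bracket (tens a' m') (cov_bracket (tens b' n') (tens c' p')) =
    \sum_(y \in [set: G]) \sum_(x \in [set: G])
      phi y ^ n' *: cov_term x a' m' (lie (act y b') c') (n' + p').
  rewrite cov_bracketUU.
  rewrite (@fsum_morph _ _ _ (cov_bracket (tens a' m')) _ (cov_bracket0r _)
    (cov_bracketDr _) (cov_term_fin b' n' c' p')).
  apply: eq_fsbigr => y _.
  rewrite cov_bracketZr cov_bracketDr cov_bracketkr addr0 cov_bracketUU.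
  exact: sumZ (cov_term_fin _ _ _ _).
have brL a' m' b' n' c' p' :
    cov_bracket (cov_bracket (tens a' m') (tens b' n')) (tens c' p') =
    \sum_(x \in [set: G]) \sum_(y \in [set: G])
      phi x ^ m' *: cov_term y (lie (act x a') b') (m' + n') c' p'.
  rewrite cov_bracketUU.
  rewrite (@fsum_morph _ _ _ (cov_bracket ^~ (tens c' p')) _ (cov_bracket0l _)
    (fun u u' => cov_bracketDl u u' _) (cov_term_fin a' m' b' n')).
  apply: eq_fsbigr => y _.
  rewrite cov_bracketZl cov_bracketDl cov_bracketkl addr0 cov_bracketUU.
  exact: sumZ (cov_term_fin _ _ _ _).
rewrite !brR brL.
set Pf := fun y x => phi y ^ n *: cov_term x a m (lie (act y b) c) (n + p).
set Qf := fun x y => phi x ^ m *: cov_term y b n (lie (act x a) c) (m + p).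
set Rf := fun x y => phi x ^ m *: cov_term y (lie (act x a) b) (m + n) c p.
have term0l x m' b' n' : cov_term x 0 m' b' n' = 0.
  by rewrite /cov_term act0 lie0l form0l mulr0 mul0r scale0r tens0 addr0 scaler0.
have term0r x a' m' n' : cov_term x a' m' 0 n' = 0.
  by rewrite /cov_term lie0r form0r mulr0 mul0r scale0r tens0 addr0 scaler0.
have sP : fin_supp2 Pf.
  apply: (@fin_supp2_iter _ _ _ _ (fun y => lie (act y b) c)) => [|y x h|y].
  - exact: cov_lie_fin.
  - by rewrite /Pf h term0r scaler0.
  - exact: finZ (cov_term_fin _ _ _ _).
have sQ : fin_supp2 Qf.
  apply: (@fin_supp2_iter _ _ _ _ (fun y => lie (act y a) c)) => [|y x h|y].
  - exact: cov_lie_fin.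
  - by rewrite /Qf h term0r scaler0.
  - exact: finZ (cov_term_fin _ _ _ _).
have sR : fin_supp2 Rf.
  apply: (@fin_supp2_iter _ _ _ _ (fun y => lie (act y a) b)) => [|y x h|y].
  - exact: cov_lie_fin.
  - by rewrite /Rf h term0l scaler0.
  - exact: finZ (cov_term_fin _ _ _ _).
have E y x : Pf y x = Rf (y^-1 * x)%g y + Qf x y.
  rewrite /Pf /Qf /Rf /cov_term.
  rewrite cov_act_lie -cov_actM mulVKg.
  have -> : phi x = phi y * phi (y^-1 * x)%g by rewrite -cov_charM mulVKg.
  have f0 := phi_neq0 y; have f1 := phi_neq0 (y^-1 * x)%g.
  rewrite !scalerA !expfzMl (expfzDr _ _ f0).
  set r := phi y; set s := phi _.
  have -> : r ^ n * (r ^ m * s ^ m) = s ^ m * (r ^ m * r ^ n) by ring.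
  have -> : r ^ m * s ^ m * r ^ n = s ^ m * (r ^ m * r ^ n) by ring.
  rewrite -scalerDr; congr (_ *: _).
  have -> : m + (n + p) = m + n + p by rewrite addrA.
  have -> : n + (m + p) = m + n + p by rewrite addrCA addrA.
  rewrite addrACA -tensD -lie_leibniz; congr (_ + _).
  rewrite -scalerDl; congr (_ *: _); rewrite -mulrDl; congr (_ * _).
  have e1 : form (act y b) (lie (act x a) c) = - form (act x a) (lie (act y b) c).
    rewrite -!cov_form_inv lieC -scaleN1r.
    have := cov_formDZl d (-1) (lie (act x a) (act y b)) 0 c.
    by rewrite addr0 form0l addr0 mulN1r.
  rewrite e1 cov_form_inv rmorphD /=; ring.
have eR : \sum_(x \in [set: G]) \sum_(y \in [set: G]) Rf x y =
    \sum_(y \in [set: G]) \sum_(x \in [set: G]) Rf (y^-1 * x)%g y.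
  apply: etrans (fsum_exchange sR) _; apply: eq_fsbigr => y _.
  apply: (@fsum_reindex _ _ _ (fun x => (y^-1 * x)%g)).
  by exists (fun x => (y * x)%g) => x; rewrite ?mulKg ?mulVKg.
have eP : \sum_(y \in [set: G]) \sum_(x \in [set: G]) Pf y x =
    \sum_(y \in [set: G]) \sum_(x \in [set: G])
      (Rf (y^-1 * x)%g y + Qf x y).
  by apply: eq_fsbigr => y _; apply: eq_fsbigr => x _; apply: E.
have sR' : fin_supp2 (fun y x => Rf (y^-1 * x)%g y).
  apply: (fin_supp2_sub sP (fin_supp2_swap (F := fun y x => Qf x y) sQ)) => y x.
  by rewrite E addrK.
apply: etrans eP _.
apply: etrans (fsum2D sR' (fin_supp2_swap (F := fun y x => Qf x y) sQ)) _.
exact: f_equal2 (esym eR) (esym (fsum_exchange sQ)).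
Qed.

Definition cov_alg : Type := Quotient.quot cov_ideal.
HB.instance Definition _ := GRing.Zmodule.on cov_alg.
HB.instance Definition _ := Quotient.on cov_alg.

Definition cov_pi (u : V) : cov_alg := (\pi_cov_alg u)%qT.

Lemma cov_piP (P : cov_alg -> Prop) : (forall u, P (cov_pi u)) -> forall q, P q.
Proof. by move=> h q; rewrite -[q]reprK; apply: h. Qed.

Lemma cov_piE u v : (cov_pi u = cov_pi v) <-> (u - v \in cov_ideal).
Proof. by rewrite Quotient.idealrBE; split => /eqP. Qed.

Lemma cov_piD u v : cov_pi (u + v) = cov_pi u + cov_pi v.
Proof. exact: (@Quotient.pi_add _ cov_ideal). Qed.

Lemma cov_piK q : cov_pi (repr q) = q.
Proof. exact: reprK. Qed.

Definition cov_scale (c : K) (q : cov_alg) : cov_alg := cov_pi (c *: repr q).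

Lemma cov_scaleE c u : cov_scale c (cov_pi u) = cov_pi (c *: u).
Proof.
by apply/cov_piE; rewrite -scalerBr; apply: rpredZ; apply/cov_piE; rewrite cov_piK.
Qed.

Definition cov_lie (p q : cov_alg) : cov_alg :=
  cov_pi (cov_bracket (repr p) (repr q)).

Lemma cov_ideal_brl u v : u \in cov_ideal -> cov_bracket u v \in cov_ideal.
Proof.
move=> /cov_idealP h.
suff -> : cov_bracket u v = 0 by apply: rpred0.
elim/lspan_ind: h => [|c w {}u [x [a [m ->]]] IH]; first exact: cov_bracket0l.
by rewrite cov_bracketDl cov_bracketZl cov_gen_bracket scaler0 add0r.
Qed.

Lemma cov_ideal_brr u v : v \in cov_ideal -> cov_bracket u v \in cov_ideal.
Proof.
move=> /(cov_ideal_brl u) h; have := cov_bracketC u v.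
by rewrite rpredDr.
Qed.

Lemma cov_lieE u v : cov_lie (cov_pi u) (cov_pi v) = cov_pi (cov_bracket u v).
Proof.
apply/cov_piE; set u' := repr _; set v' := repr _.
have hu : u' - u \in cov_ideal by apply/cov_piE; rewrite cov_piK.
have hv : v' - v \in cov_ideal by apply/cov_piE; rewrite cov_piK.
have -> : cov_bracket u' v' - cov_bracket u v =
    cov_bracket (u' - u) v' + cov_bracket u (v' - v).
  rewrite cov_bracketDl cov_bracketDr cov_bracketNl cov_bracketNr.
  by rewrite addrA subrK.
by apply: rpredD; [apply: cov_ideal_brl | apply: cov_ideal_brr].
Qed.

Fact cov_scaleA c e q : cov_scale c (cov_scale e q) = cov_scale (c * e) q.
Proof. by elim/cov_piP: q => u; rewrite !cov_scaleE scalerA. Qed.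
Fact cov_scale1 : left_id 1 cov_scale.
Proof. by elim/cov_piP => u; rewrite cov_scaleE scale1r. Qed.
Fact cov_scaleDr : right_distributive cov_scale +%R.
Proof.
move=> c p q; elim/cov_piP: p => u; elim/cov_piP: q => v.
by rewrite -cov_piD !cov_scaleE scalerDr cov_piD.
Qed.
Fact cov_scaleDl q : {morph cov_scale^~ q : c e / c + e}.
Proof.
by move=> c e; elim/cov_piP: q => u; rewrite !cov_scaleE scalerDl cov_piD.
Qed.
HB.instance Definition _ := GRing.Zmodule_isLmodule.Build K cov_alg
  cov_scaleA cov_scale1 cov_scaleDr cov_scaleDl.

Lemma cov_piDZ c u v : cov_pi (c *: u + v) = c *: cov_pi u + cov_pi v.
Proof. by rewrite cov_piD -cov_scaleE. Qed.

Lemma cov_pi0 : cov_pi 0 = 0.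
Proof. by apply: (addrI (cov_pi 0)); rewrite -cov_piD !addr0. Qed.

Fact cov_lieDZl c p q r : cov_lie (c *: p + q) r = c *: cov_lie p r + cov_lie q r.
Proof.
elim/cov_piP: p => u; elim/cov_piP: q => v; elim/cov_piP: r => w.
by rewrite -cov_piDZ !cov_lieE cov_bracketDl cov_bracketZl cov_piDZ.
Qed.
Fact cov_lieDZr c p q r : cov_lie p (c *: q + r) = c *: cov_lie p q + cov_lie p r.
Proof.
elim/cov_piP: p => u; elim/cov_piP: q => v; elim/cov_piP: r => w.
by rewrite -cov_piDZ !cov_lieE cov_bracketDr cov_bracketZr cov_piDZ.
Qed.
Fact cov_lieC p q : cov_lie p q = - cov_lie q p.
Proof.
elim/cov_piP: p => u; elim/cov_piP: q => v; rewrite !cov_lieE.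
apply/eqP; rewrite -addr_eq0 -cov_piD -cov_pi0; apply/eqP/cov_piE.
by rewrite subr0; apply: cov_bracketC.
Qed.
Fact cov_liexx p : cov_lie p p = 0.
Proof. exact: opp_fixed0 (cov_lieC p p). Qed.
Fact cov_lie_jacobi p q r :
  cov_lie p (cov_lie q r) + cov_lie q (cov_lie r p) + cov_lie r (cov_lie p q) = 0.
Proof.
have -> : cov_lie p (cov_lie q r)
    = cov_lie (cov_lie p q) r + cov_lie q (cov_lie p r).
  elim/cov_piP: p => u; elim/cov_piP: q => v; elim/cov_piP: r => w.
  by rewrite !cov_lieE cov_bracket_leibniz cov_piD.
rewrite (cov_lieC r (cov_lie p q)) (cov_lieC r p).
have -> : cov_lie q (- cov_lie p r) = - cov_lie q (cov_lie p r).
  have := cov_lieDZr (-1) q (cov_lie p r) 0; have := cov_lieDZr 1 q 0 0.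
  rewrite scale1r !addr0 scale1r => /eqP; rewrite -subr_eq subrr => /eqP <-.
  by rewrite addr0 !scaleN1r.
by rewrite addrK subrr.
Qed.

HB.instance Definition _ := Lmodule_isLie.Build K cov_alg
  cov_lieDZl cov_lieDZr cov_liexx cov_lie_jacobi.

Definition cov_k : cov_alg := cov_pi aff_k.
Definition cov_img (a : g) (m : int) : cov_alg := cov_pi (tens a m).

End Covariant.

Section SD.
Variable S : zmodType.

(* [(gamma, e)] stands for gamma \hat\tau_chi^e.  This is the subgroup generated
   by S and \hat\tau_chi: S acts faithfully, and \hat\tau_chi has order exactly
   two and is not in S, since it negates every L_{0,beta}. *)
Definition SD : Type := (S * bool)%type.
HB.instance Definition _ := Choice.on SD.

Definition SD_one : SD := (0, false).
Definition SD_inv (x : SD) : SD := (- x.1, x.2).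
Definition SD_mul (x y : SD) : SD := (x.1 + y.1, x.2 (+) y.2).

Fact SD_mulA : associative SD_mul.
Proof. by move=> x y z; rewrite /SD_mul /= addrA addbA. Qed.
Fact SD_mul1 : left_id SD_one SD_mul.
Proof. by case=> a e; rewrite /SD_mul /= add0r. Qed.
Fact SD_mulr1 : right_id SD_one SD_mul.
Proof. by case=> a e; rewrite /SD_mul /= addr0 addbF. Qed.
Fact SD_mulV : left_inverse SD_one SD_inv SD_mul.
Proof. by case=> a e; rewrite /SD_mul /= addNr addbb. Qed.
Fact SD_mulrV : right_inverse SD_one SD_inv SD_mul.
Proof. by case=> a e; rewrite /SD_mul /= addrN addbb. Qed.
HB.instance Definition _ := isGroup.Build SD
  SD_mulA SD_mul1 SD_mulr1 SD_mulV SD_mulrV.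

End SD.

Section LSCovariant.
Variables (K : numFieldType) (S : zmodType) (chi : character S K).
Local Notation L := (LS K S).
Local Notation Lg := (@Lgen K S).

Definition sigma (gamma : S) : L -> L :=
  lin_ext (fun x : S * S => Lg x.1 (x.2 + gamma)).

Definition tau_chi : L -> L :=
  lin_ext (fun x : S * S => - (chi (x.1 *+ 2) *: Lg (- x.1) x.2)).

Definition SD_act (x : SD S) (a : L) : L :=
  sigma x.1 (if x.2 then tau_chi a else a).

Definition SD_char (x : SD S) : K := chi x.1.

Fact sigma_linear c : linear (sigma c).
Proof. exact: lin_ext_linear. Qed.
HB.instance Definition _ c := GRing.isLinear.Build K L L _ (sigma c) (sigma_linear c).

Fact tau_chi_linear : linear tau_chi.
Proof. exact: lin_ext_linear. Qed.
HB.instance Definition _ := GRing.isLinear.Build K L L _ tau_chi tau_chi_linear.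

Lemma sigmaE c a b : sigma c (Lg a b) = Lg a (b + c).
Proof. exact: lin_extU. Qed.
Lemma tau_chiE a b : tau_chi (Lg a b) = - (chi (a *+ 2) *: Lg (- a) b).
Proof. exact: lin_extU. Qed.

Lemma LS_linear_eq (f f' : L -> L) : linear f -> linear f' ->
  (forall a b, f (Lg a b) = f' (Lg a b)) -> f =1 f'.
Proof.
move=> fl fl' h; have f0 (h' : L -> L) : linear h' -> h' 0 = 0.
  move=> hl; have := hl 1 0 0; rewrite !scale1r addr0 => /eqP.
  by rewrite -subr_eq subrr => /eqP.
elim/LS_ind => [|c u v IH IH'|a b]; first by rewrite !f0.
  by rewrite fl fl' IH IH'.
exact: h.
Qed.

Lemma sigma0 a : sigma 0 a = a.
Proof.
apply: (@LS_linear_eq _ id (sigma_linear 0)) => // b c.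
by rewrite sigmaE addr0.
Qed.

Lemma sigmaD b c a : sigma (b + c) a = sigma b (sigma c a).
Proof.
apply: (@LS_linear_eq _ (sigma b \o sigma c) (sigma_linear _)) => [|m n].
  by move=> k u v; rewrite /= !sigma_linear.
by rewrite /= !sigmaE -addrA (addrC c).
Qed.

Lemma sigma_tau c a : sigma c (tau_chi a) = tau_chi (sigma c a).
Proof.
apply: (@LS_linear_eq (sigma c \o tau_chi) (tau_chi \o sigma c)) => [||m n].
- by move=> k u v; rewrite /= tau_chi_linear sigma_linear.
- by move=> k u v; rewrite /= sigma_linear tau_chi_linear.
by rewrite /= sigmaE !tau_chiE linearN linearZ /= sigmaE.
Qed.

Lemma tau_chiK a : tau_chi (tau_chi a) = a.
Proof.
apply: (@LS_linear_eq (tau_chi \o tau_chi) id) => [||m n].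
- by move=> k u v; rewrite /= !tau_chi_linear.
- by [].
rewrite /= tau_chiE linearN linearZ /= tau_chiE scalerN opprK opprK scalerA.
by rewrite -charD mulNrn subrr char0 scale1r.
Qed.

Lemma sigma_mul c u v : sigma c (Lmul u v) = Lmul (sigma c u) (sigma c v).
Proof.
elim/LS_ind: u => [|k u u' IH IH'|a b].
- by rewrite Lmul0l linear0 Lmul0l.
- by rewrite LmulDZl !sigma_linear LmulDZl IH IH'.
elim/LS_ind: v => [|k v v' IH IH'|m n].
- by rewrite Lmul0r linear0 Lmul0r.
- by rewrite LmulDZr !sigma_linear LmulDZr IH IH'.
rewrite LmulE linearZ /= !sigmaE LmulE addrA; congr (_%:R *: _).
by congr nat_of_bool; rewrite opprD addrACA subrr addr0.
Qed.

Lemma tau_chi_mul u v : tau_chi (Lmul u v) = - Lmul (tau_chi v) (tau_chi u).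
Proof.
elim/LS_ind: u => [|k u u' IH IH'|a b].
- by rewrite Lmul0l linear0 Lmul0r oppr0.
- by rewrite LmulDZl !tau_chi_linear LmulDZr IH IH' opprD scalerN.
elim/LS_ind: v => [|k v v' IH IH'|m n].
- by rewrite Lmul0r linear0 Lmul0l oppr0.
- by rewrite LmulDZr !tau_chi_linear LmulDZl IH IH' opprD scalerN.
have NN x y (p q : L) : Lmul (- (x *: p)) (- (y *: q)) = (x * y) *: Lmul p q.
  by rewrite LmulNl LmulNr opprK LmulZl LmulZr scalerA.
rewrite !tau_chiE NN !LmulE linearZ /= tau_chiE.
rewrite scalerN !scalerA -charD -mulrnDl -opprD (addrC m a) mulrC.
have [e|ne] := eqVneq (a + m) (b - n).
  have e' : - (a + m) == n - b by rewrite e opprB.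
  have -> : - m + b = a + n.
    have -> : b = a + m + n by rewrite e subrK.
    by rewrite -addrA addrCA addKr.
  by rewrite e' !mulr1 -scaleNr.
have -> : (- (a + m) == n - b) = false.
  by apply/negbTE; apply: contraNneq ne => e; rewrite -[a + m]opprK e opprB.
by rewrite !mulr0 !scale0r.
Qed.

Lemma tau_chi_lie u v : tau_chi (lie u v) = lie (tau_chi u) (tau_chi v).
Proof.
rewrite -[lie u v]/(Lmul u v - Lmul v u) linearB /= !tau_chi_mul opprK addrC.
by [].
Qed.

Lemma sigma_lie c u v : sigma c (lie u v) = lie (sigma c u) (sigma c v).
Proof. by rewrite -[lie u v]/(Lmul u v - Lmul v u) linearB /= !sigma_mul. Qed.

Lemma LformDZl c (u v w : L) :
  Lform (c *: u + v) w = c * Lform u w + Lform v w.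
Proof. exact: (bilin_extl (@Lform_gen K S)). Qed.
Lemma LformDZr c (u v w : L) :
  Lform u (c *: v + w) = c * Lform u v + Lform u w.
Proof. exact: (bilin_extr (@Lform_gen K S)). Qed.
Lemma Lform0l (u : L) : Lform 0 u = 0.
Proof. exact: (bilin_ext0l (@Lform_gen K S)). Qed.
Lemma Lform0r (u : L) : Lform u 0 = 0.
Proof. exact: (linear0 (bilin_ext (@Lform_gen K S) u)). Qed.
Lemma LformZl c (u v : L) : Lform (c *: u) v = c * Lform u v.
Proof. by have := LformDZl c u 0 v; rewrite Lform0l !addr0. Qed.
Lemma LformZr c (u v : L) : Lform u (c *: v) = c * Lform u v.
Proof. by have := LformDZr c u v 0; rewrite Lform0r !addr0. Qed.
Lemma LformBl (u v w : L) : Lform (u - v) w = Lform u w - Lform v w.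
Proof. by have := LformDZl (-1) v u w; rewrite scaleN1r mulN1r ![- _ + _]addrC. Qed.
Lemma LformBr (u v w : L) : Lform w (u - v) = Lform w u - Lform w v.
Proof. by have := LformDZr (-1) w v u; rewrite scaleN1r mulN1r ![- _ + _]addrC. Qed.

Lemma LformE a b m n :
  Lform (Lg a b) (Lg m n) = (a + m == 0)%:R * (b == n)%:R.
Proof. exact: (bilin_extUU (@Lform_gen K S) (a, b) (m, n)). Qed.

Lemma LformC (u v : L) : Lform u v = Lform v u.
Proof.
elim/LS_ind: u => [|c u u' IH IH'|a b]; first by rewrite Lform0l Lform0r.
  by rewrite LformDZl LformDZr IH IH'.
elim/LS_ind: v => [|c u u' IH IH'|m n]; first by rewrite Lform0l Lform0r.
  by rewrite LformDZl LformDZr IH IH'.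
by rewrite !LformE (addrC a) (eq_sym b).
Qed.

Lemma Lform_mul (u v w : L) : Lform (Lmul u v) w = Lform u (Lmul v w).
Proof.
elim/LS_ind: u => [|c u u' IH IH'|a b]; first by rewrite Lmul0l !Lform0l.
  by rewrite LmulDZl !LformDZl IH IH'.
elim/LS_ind: v => [|c u u' IH IH'|m n].
- by rewrite Lmul0l Lmul0r Lform0r Lform0l.
- by rewrite LmulDZl LmulDZr LformDZl LformDZr IH IH'.
elim/LS_ind: w => [|c u u' IH IH'|r s].
- by rewrite Lmul0r !Lform0r.
- by rewrite LmulDZr !LformDZr IH IH'.
rewrite !LmulE LformZl LformZr !LformE addrA.
have [e|_] := eqVneq (a + m + r) 0; last by rewrite !mul0r !mulr0.
have rE : m + r = - a by apply/eqP; rewrite -addr_eq0 addrC addrA e.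
rewrite !mul1r rE -!natrM !mulnb; congr (_%:R); congr nat_of_bool.
apply/idP/idP => /andP[/eqP h /eqP h'].
  rewrite -h' opprD addrCA subrr addr0 eqxx /=.
  by rewrite addrA (addrC m) h subrK.
have sE : s = a + n by rewrite -[a]opprK h opprB addrC addrCA subrr addr0.
by rewrite h' sE addrA (addrC m) addrK !eqxx.
Qed.

Lemma Lform_inv (u v w : L) : Lform (lie u v) w = Lform u (lie v w).
Proof.
rewrite -[lie u v]/(Lmul u v - Lmul v u) -[lie v w]/(Lmul v w - Lmul w v).
rewrite LformBl LformBr !Lform_mul; congr (_ - _).
by rewrite LformC Lform_mul.
Qed.

Lemma sigma_form c u v : Lform (sigma c u) (sigma c v) = Lform u v.
Proof.
elim/LS_ind: u => [|k u u' IH IH'|a b]; first by rewrite linear0 !Lform0l.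
  by rewrite sigma_linear !LformDZl IH IH'.
elim/LS_ind: v => [|k u u' IH IH'|m n]; first by rewrite linear0 !Lform0r.
  by rewrite sigma_linear !LformDZr IH IH'.
by rewrite !sigmaE !LformE (inj_eq (addIr c)).
Qed.

Lemma tau_chi_form u v : Lform (tau_chi u) (tau_chi v) = Lform u v.
Proof.
elim/LS_ind: u => [|k u u' IH IH'|a b]; first by rewrite linear0 !Lform0l.
  by rewrite tau_chi_linear !LformDZl IH IH'.
elim/LS_ind: v => [|k u u' IH IH'|m n]; first by rewrite linear0 !Lform0r.
  by rewrite tau_chi_linear !LformDZr IH IH'.
rewrite !tau_chiE -!scaleNr LformZl LformZr !LformE -opprD oppr_eq0.
rewrite mulrA mulrNN -charD -mulrnDl.
have [->|_] := eqVneq (a + m) 0; last by rewrite !mul0r mulr0.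
by rewrite mul0rn char0 mul1r.
Qed.

Fact SD_actDZ x c a b : SD_act x (c *: a + b) = c *: SD_act x a + SD_act x b.
Proof.
by rewrite /SD_act; case: x.2; rewrite ?tau_chi_linear sigma_linear.
Qed.
Fact SD_act1 a : SD_act 1%g a = a.
Proof. exact: sigma0. Qed.
Fact SD_actM x y a : SD_act (x * y)%g a = SD_act x (SD_act y a).
Proof.
case: x y => [b e] [c f]; rewrite /SD_act /=.
rewrite sigmaD; case: e; case: f; rewrite ?[addb _ _]/=; first last.
- by [].
- by [].
- by rewrite (sigma_tau c a).
by rewrite -(sigma_tau c (tau_chi a)) tau_chiK.
Qed.
Fact SD_act_lie x a b : SD_act x (lie a b) = lie (SD_act x a) (SD_act x b).
Proof. by rewrite /SD_act; case: x.2; rewrite ?tau_chi_lie sigma_lie. Qed.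
Fact SD_act_form x a b : Lform (SD_act x a) (SD_act x b) = Lform a b.
Proof. by rewrite /SD_act; case: x.2; rewrite sigma_form ?tau_chi_form. Qed.

Lemma SD_act0 x : SD_act x 0 = 0.
Proof. by rewrite /SD_act; case: x.2; rewrite ?linear0. Qed.

Lemma SD_finite (W : zmodType) (F : L -> L -> W) (X : S -> S -> S -> S -> seq S) :
  (forall b, F 0 b = 0) -> (forall a, F a 0 = 0) ->
  (forall c a a' b, F a b = 0 -> F a' b = 0 -> F (c *: a + a') b = 0) ->
  (forall c a b b', F a b = 0 -> F a b' = 0 -> F a (c *: b + b') = 0) ->
  (forall c a b m n x, F (sigma c (Lg a b)) (Lg m n) <> 0 -> x = c -> x \in X a b m n) ->
  forall a b, finite_set [set x : SD S | F (SD_act x a) b <> 0].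
Proof.
move=> F0l F0r FDl FDr FX.
have finU (P Q R : set (SD S)) : finite_set P -> finite_set Q ->
    (forall x, R x -> ~ P x -> Q x) -> finite_set R.
  move=> fP fQ h; apply: (sub_finite_set (B := P `|` Q)); last first.
    by rewrite finite_setU.
  by move=> x Rx; have [Px|Px] := pselect (P x); [left|right; apply: h].
have fin0 (P : set (SD S)) : (forall x, ~ P x) -> finite_set P.
  move=> h; apply: (sub_finite_set (B := set0)) => [x /h //|].
  exact: finite_set0.
move=> a b; elim/LS_ind: a => [|c u u' IH IH'|a b'].
- by apply: fin0 => x /=; rewrite SD_act0 F0l.
- apply: (finU _ _ _ IH IH') => x /= h /contrapT h1 h2.
  by apply: h; rewrite SD_actDZ; apply: FDl.
elim/LS_ind: b => [|c u u' IH IH'|m n].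
- by apply: fin0 => x /=; rewrite F0r.
- apply: (finU _ _ _ IH IH') => x /= h /contrapT h1 h2.
  by apply: h; apply: FDr.
pose s := [seq (c, e) : SD S | c <- X a b' m n ++ X (- a) b' m n, e <- [:: true; false]].
apply: (sub_finite_set (B := [set` s])); last exact: finite_seq.
move=> [c e] /= h; apply/allpairsP; exists (c, e); split=> //=; last by case: (e).
rewrite mem_cat; move: h; rewrite /SD_act /=; case: e => h; apply/orP.
  right; apply: (FX c) => // h'; apply: h.
  rewrite tau_chiE -scaleNr linearZ /=.
  by rewrite -[_ *: _]addr0; apply: FDl.
by left; apply: (FX c).
Qed.

Fact SD_lie_fin a b : finite_set [set x : SD S | lie (SD_act x a) b <> 0].
Proof.
apply: (@SD_finite _ (fun a b => lie a b)
  (fun a b m n => [:: a + m + n - b; n - b - (a + m)])).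
- exact: lie0l.
- exact: lie0r.
- by move=> c u u' v h h'; rewrite lieDZl h h' scaler0 addr0.
- by move=> c u v v' h h'; rewrite lieDZr h h' scaler0 addr0.
move=> c {}a {}b m n x h ->{x}; apply: contra_notT h; rewrite !inE negb_or.
move=> /andP[h1 h2]; rewrite sigmaE -[lie _ _]/(Lmul _ _ - Lmul _ _) !LmulE.
have -> : (a + m == b + c - n) = false.
  apply: contraNF h1 => /eqP e.
  by rewrite e subrK addrC addKr.
have -> : (m + a == n - (b + c)) = false.
  apply: contraNF h2 => /eqP e.
  by rewrite (addrC a) e opprB [_ + (_ - n)]addrC addrA subrK (addrC b) addrK.
by rewrite !scale0r subrr.
Qed.

Fact SD_form_fin a b : finite_set [set x : SD S | Lform (SD_act x a) b <> 0].
Proof.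
apply: (@SD_finite _ (fun a b => Lform a b) (fun a b m n => [:: n - b])).
- exact: Lform0l.
- exact: Lform0r.
- by move=> c u u' v h h'; rewrite LformDZl h h' mulr0 addr0.
- by move=> c u v v' h h'; rewrite LformDZr h h' mulr0 addr0.
move=> c {}a {}b m n x h ->{x}; apply: contra_notT h; rewrite !inE.
move=> h1; rewrite sigmaE LformE.
have -> : (b + c == n) = false.
  by apply: contraNF h1 => /eqP <-; rewrite addrC addKr.
by rewrite mulr0.
Qed.

Fact SD_char1 : SD_char 1%g = 1. Proof. exact: char0. Qed.
Fact SD_charM x y : SD_char (x * y)%g = SD_char x * SD_char y.
Proof. exact: charD. Qed.

Definition SD_covariant : covariant_data L (SD S) :=
  @CovariantData K L (SD S)
    (@Lform K S) LformDZl LformC Lform_inv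
    SD_act SD_actDZ SD_act1 SD_actM SD_act_lie SD_act_form
    SD_lie_fin SD_form_fin SD_char SD_char1 SD_charM.

End LSCovariant.

(* Main.v *)
Require Import Defs.
From HB Require Import structures.
From mathcomp Require Import all_boot all_order all_algebra.
From mathcomp Require Import reals complex.
From mathcomp Require Import finmap classical_sets fsbigop monalg.

Set Implicit Arguments.
Unset Strict Implicit.
Unset Printing Implicit Defensive.

Import GRing.Theory Num.Theory.
Local Open Scope ring_scope.

(**
Write [C] for the covariant algebra, [tau] for the involution of [Ahat] whose
fixed points are [Dhat], and [a(m)] for the class of [a t^m] in [C].

Let [H : Ahat -> C] be the linear map with [A_{alpha,m} |-> L_{alpha,0}(m)] and
[c |-> k]. In [C] one has [(tau_chi a)(m) = a(m)], because the character is 1 on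
[tau_chi], so [H o tau = H]; since every [u] in [Dhat] is half of [u + tau u], the required
map is [f = H / 2] on [Dhat] ([D_to_cov]), which explains the factor 1/2 on the
central element.

That [f] preserves brackets reduces to the identity
  [ [H u, H v] = H [u + tau u, v] ]  for all [u, v] in [Ahat]
([A_to_cov_lie]), because [u + tau u = 2 u] when [u] is fixed. On generators
its left-hand side is a sum over [S x {1, tau_chi}]; the coset of 1 contributes
[H [u, v]] and the coset of [tau_chi] contributes [H [tau u, v]]. In the coset of
1, the bracket of [L_{alpha,gamma}] with [L_{beta,0}] is supported on
[gamma = alpha + beta] and [gamma = - (alpha + beta)], and the form on
[gamma = 0]; the first two points give the two values of [chi] in the structure
constant of [Ahat], the third its central term ([cov_sliceE]).

The inverse sends [L_{alpha,beta}(m)] to [chi(beta)^(-m) D_{alpha,m}] and [k] to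
[2 c]. It is forced by [L_{alpha,beta}(m) = chi(beta)^(-m) L_{alpha,0}(m)]
([img_sigma]), and it is well defined because it is constant on the orbits of the
group ([L_to_D_act]). Uniqueness of [f] holds since the [D_{alpha,m}] and [c]
span [Dhat] ([D_linear_eq]).
*)

(** * Characters and finitely supported sums *)

Lemma charMz (S : zmodType) (K : fieldType) (chi : character S K) x (m : int) :
  chi (x *~ m) = chi x ^ m.
Proof.
have charMn n : chi (x *+ n) = chi x ^+ n.
  elim: n => [|n IH]; first by rewrite mulr0n char0 expr0.
  by rewrite mulrS charD IH exprS.
case: m => n; first exact: charMn.
by rewrite NegzE mulrNz charN -exprnN; congr (_^-1); apply: charMn.
Qed.

Section PointSums.
Variables (T : choiceType) (K : nzRingType) (V : lmodType K).
Implicit Types (x y : T) (v : V).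

Let point y v x := (x == y)%:R *: v.

Lemma fin_supp_point y v : fin_supp (point y v).
Proof.
apply/fin_suppP; exists [fset y]%fset => x; rewrite in_fset1 /point.
by case: eqP => // _; rewrite scale0r.
Qed.

Lemma fsum_point y v : \sum_(x \in [set: T]%classic) point y v x = v.
Proof.
rewrite (fsumE (X := [fset y]%fset)) => [|x].
  by rewrite big_seq_fset1 /point eqxx scale1r.
by rewrite in_fset1 /point; case: eqP => // _; rewrite scale0r.
Qed.

(** In each coset of the translations, the bracket and the form of two basis
elements are nonzero at three points at most; the points may coincide, which is why the summand is a sum of point masses and not a case distinction. *)
Lemma fsum_point3 y1 y2 y3 v1 v2 v3 (F : T -> V) :
  (forall x, F x = point y1 v1 x + point y2 v2 x + point y3 v3 x) ->
  fin_supp F /\ \sum_(x \in [set: T]%classic) F x = v1 + v2 + v3.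
Proof.
move=> FE; have fp := fin_supp_point.
have f12 := fin_suppD (fp y1 v1) (fp y2 v2).
split.
  have -> : F = fun x => point y1 v1 x + point y2 v2 x + point y3 v3 x.
    exact/boolp.funext.
  exact: fin_suppD.
under eq_fsbigr do rewrite FE.
rewrite (fsumD f12 (fp y3 v3)) (fsumD (fp y1 v1) (fp y2 v2)).
by rewrite !fsum_point.
Qed.

End PointSums.

(** * Linear maps out of affine and covariant algebras *)

Section LoopExtension.
Variables (K : nzRingType) (g V : lmodType K) (h : int -> {linear g -> V}).

Definition loop_ext (u : loop g) : V := \sum_(m <- msupp u) h m u@_m.

Lemma loop_ext_linear : linear loop_ext.
Proof.
have wide (d : {fset int}) (u : loop g) : (msupp u `<=` d)%fset ->
    loop_ext u = \sum_(m <- d) h m u@_m.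
  by move=> le; apply: big_fset_incl => // m _ /mcoeff_outdom ->; rewrite linear0.
move=> c u v; set d := (msupp u `|` msupp v `|` msupp (c *: u + v))%fset.
have dE : [/\ msupp u `<=` d, msupp v `<=` d & msupp (c *: u + v) `<=` d]%fset.
  by rewrite /d; split; apply/fsubsetP => x; rewrite !in_fsetU => ->; rewrite ?orbT.
case: dE => du dv duv; rewrite (wide d _ duv) (wide d _ du) (wide d _ dv).
rewrite scaler_sumr -big_split; apply: eq_bigr => m _ /=.
by rewrite mcoeffD loop_coeffZ linearP.
Qed.

HB.instance Definition _ :=
  GRing.isLinear.Build K (loop g) V _ loop_ext loop_ext_linear.

Lemma loop_extU a m : loop_ext << a *g m >> = h m a.
Proof.
rewrite /loop_ext msuppU; case: eqP => [->|_]; last first.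
  by rewrite big_seq_fset1 mcoeffUU.
by rewrite big_seq_fset0 linear0.
Qed.

Definition affine_ext (w : V) (u : affine g) : V := loop_ext u.1 + u.2 *: w.

Lemma affine_ext_linear w : linear (affine_ext w).
Proof.
move=> c u v; rewrite /affine_ext /= linearP scalerDl scalerDr scalerA.
by rewrite addrACA.
Qed.

HB.instance Definition _ w :=
  GRing.isLinear.Build K (affine g) V _ (affine_ext w) (affine_ext_linear w).

Lemma affine_ext_tens w a m : affine_ext w (tens a m) = h m a.
Proof. by rewrite /affine_ext /= loop_extU scale0r addr0. Qed.

Lemma affine_ext_k w : affine_ext w aff_k = w.
Proof. by rewrite /affine_ext /= linear0 scale1r add0r. Qed.

End LoopExtension.

Section CovariantQuotient.
Variables (K : numFieldType) (g : lieType K) (G : groupType).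
Variable d : covariant_data g G.

Fact cov_pi_linear : linear (cov_pi d).
Proof. exact: cov_piDZ. Qed.
HB.instance Definition _ :=
  GRing.isLinear.Build K (affine g) (cov_alg d) _ (cov_pi d) cov_pi_linear.

Lemma cov_imgD a b m : cov_img d (a + b) m = cov_img d a m + cov_img d b m.
Proof. by rewrite /cov_img tensD linearD. Qed.

Lemma cov_imgZ c a m : cov_img d (c *: a) m = c *: cov_img d a m.
Proof. by rewrite /cov_img tensZ linearZ. Qed.

Lemma cov_imgN a m : cov_img d (- a) m = - cov_img d a m.
Proof. by rewrite /cov_img tensN linearN. Qed.

Lemma cov_img_act x a m :
  cov_char d x ^ m *: cov_img d (cov_act d x a) m = cov_img d a m.
Proof.
rewrite /cov_img -linearZ; apply/cov_piE; exact: cov_gen_ideal.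
Qed.

Lemma lie_cov_img a m b n :
  lie (cov_img d a m) (cov_img d b n) =
  \sum_(x \in [set: G]%classic) cov_pi d (cov_term d x a m b n).
Proof.
rewrite [LHS]cov_lieE cov_bracketUU.
apply: fsum_morph (cov_term_fin d a m b n); [exact: linear0 | exact: linearD].
Qed.

Lemma cov_k_lie_l p : lie (cov_k d) p = 0.
Proof.
elim/cov_piP: p => u; rewrite [LHS]cov_lieE -[aff_k]scale1r cov_bracketkl.
exact: linear0.
Qed.

Lemma cov_k_lie_r p : lie p (cov_k d) = 0.
Proof. by rewrite lieC cov_k_lie_l oppr0. Qed.

Section Descent.
Variables (V : lmodType K) (F : {linear affine g -> V}).
Hypothesis F_inv : forall x a m,
  cov_char d x ^ m *: F (tens (cov_act d x a) m) = F (tens a m).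

(** The value at the chosen representative; [cov_liftE] shows that the choice
does not matter when [F] is constant on twisted orbits. *)
Definition cov_lift (p : cov_alg d) : V := F (repr p).

Lemma cov_liftE u : cov_lift (cov_pi d u) = F u.
Proof.
have /cov_piE/cov_idealP := cov_piK (cov_pi d u).
rewrite /cov_lift => h; apply/eqP; rewrite -subr_eq0 -linearB; apply/eqP.
move: h; set v := _ - u; clearbody v.
elim/lspan_ind => [|c w {}v [x [a [m ->]]] IH]; first exact: linear0.
by rewrite linearP IH addr0 linearB linearZ /= F_inv subrr scaler0.
Qed.

Lemma cov_lift_linear : linear cov_lift.
Proof.
move=> c p q; elim/cov_piP: p => u; elim/cov_piP: q => v.
by rewrite -linearP !cov_liftE linearP.
Qed.

End Descent.
End CovariantQuotient.

(** * The isomorphism *)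

Section Isomorphism.
Variables (K : numFieldType) (S : zmodType) (chi : character S K).
Local Notation A := (Ahat chi).
Local Notation D := (Dhat chi).
Local Notation cov := (SD_covariant chi).
Local Notation C := (cov_alg cov).
Local Notation L := (@Lgen K S).
Local Notation img := (cov_img cov).

Fact two_neq0 : 2 != 0 :> K. Proof. by rewrite pnatr_eq0. Qed.

Fact D_sym_subproof (u : A) : Dpred (u + tauD u).
Proof. by rewrite /Dpred /= linearD /= tauDK addrC. Qed.
Definition D_sym (u : A) : D := Sub (u + tauD u) (D_sym_subproof u).

Fact D_sym_linear : linear D_sym.
Proof.
by move=> c u v; apply: val_inj; rewrite /= linearP /= scalerDr addrACA.
Qed.
HB.instance Definition _ := GRing.isLinear.Build K A D _ D_sym D_sym_linear.

Lemma D_sym_gen a m : D_sym (Agen chi a m) = Dgen chi a m.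
Proof. exact: val_inj. Qed.

Lemma D_sym_c : D_sym (Ac chi) = 2 *: Dc chi.
Proof. by apply: val_inj; rewrite /= tauD_c scaler_nat. Qed.

Lemma tauD_val (u : D) : tauD (val u) = val u.
Proof. exact/eqP/(valP u). Qed.

Lemma D_sym_val (u : D) : 2^-1 *: D_sym (val u) = u.
Proof.
apply: val_inj; rewrite /= tauD_val -mulr2n -scaler_nat scalerA.
by rewrite mulVf ?two_neq0 // scale1r.
Qed.

(** The [D_{alpha,m}] satisfy the relation that [tau_chi] imposes on the classes
[L_{alpha,0}(m)] ([img_tau]): this makes the inverse map well defined. *)
Lemma D_tau_gen a m : - (chi (a *+ 2) *: Dgen chi (- a) m) = Dgen chi a m.
Proof.
apply: val_inj; rewrite /= !tauD_A scalerDr opprD opprK scalerN opprK scalerA.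
by rewrite -charD mulNrn subrr char0 scale1r addrC.
Qed.

(** Every class is a multiple of some [L_{alpha,0}(m)], because the translation by
[b] moves [L_{a,0}] to [L_{a,b}]. *)
Lemma img_sigma a b m : img (L a b) m = chi b ^ (- m) *: img (L a 0) m.
Proof.
rewrite -(cov_img_act cov ((b, false) : SD S) (L a 0) m).
rewrite /= /SD_act /SD_char /= sigmaE add0r scalerA -expfzDr ?char_neq0 //.
by rewrite addNr expr0z scale1r.
Qed.

Lemma img_tau a m : - (chi (a *+ 2) *: img (L (- a) 0) m) = img (L a 0) m.
Proof.
rewrite -[RHS](cov_img_act cov ((0, true) : SD S)).
rewrite /= /SD_act /SD_char /= sigma0 tau_chiE char0 exp1rz scale1r.
by rewrite cov_imgN cov_imgZ.
Qed.

Definition A_to_cov : A -> C :=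
  lin_ext (fun i => if i is Some (a, m) then img (L a 0) m else cov_k cov).
Fact A_to_cov_linear : linear A_to_cov.
Proof. exact: lin_ext_linear. Qed.
HB.instance Definition _ :=
  GRing.isLinear.Build K A C _ A_to_cov A_to_cov_linear.

Lemma A_to_cov_gen a m : A_to_cov (Agen chi a m) = img (L a 0) m.
Proof. exact: lin_extU. Qed.
Lemma A_to_cov_c : A_to_cov (Ac chi) = cov_k cov.
Proof. exact: lin_extU. Qed.

Lemma A_to_cov_tau u : A_to_cov (tauD u) = A_to_cov u.
Proof.
elim/Ahat_ind: u => [|c u v IH IH'||a m]; first by rewrite !linear0.
- by rewrite linearP /= linearP /= IH IH' linearP.
- by rewrite tauD_c.
by rewrite tauD_A linearN linearZ /= !A_to_cov_gen img_tau.
Qed.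

(** The term of the covariant bracket of [L_{a,0}(m)] and [L_{b,0}(n)] indexed by
the translation [c]; by [cov_term_slice] the terms indexed by [c] times the
involution are multiples of slices for [- a]. *)
Definition cov_slice a m b n (c : S) : C :=
  chi c ^ m *: (img (lie (L a c) (L b 0)) (m + n)
    + (m%:~R * Lform (L a c) (L b 0) * (m + n == 0)%:R) *: cov_k cov).

Lemma cov_term_slice a m b n (x : SD S) :
  cov_pi cov (cov_term cov x (L a 0) m (L b 0) n) =
  if x.2 then - (chi (a *+ 2) *: cov_slice (- a) m b n x.1)
  else cov_slice a m b n x.1.
Proof.
have piE k u e : cov_pi cov (k *: (tens u (m + n) + e *: aff_k))
    = k *: (img u (m + n) + e *: cov_k cov).
  by rewrite linearZ /= linearD /= linearZ.
rewrite /cov_term piE /= /SD_char; case: x => c [] /=; last first.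
  by rewrite /SD_act /= sigmaE add0r.
rewrite /SD_act /= tau_chiE -scaleNr linearZ /= sigmaE add0r lieZl LformZl.
rewrite /cov_slice cov_imgZ -[RHS]scaleNr [RHS]scalerA [in RHS]mulrC -[RHS]scalerA.
congr (_ *: _); rewrite scalerDr scalerA; congr (_ + _ *: _).
by rewrite mulrCA !mulrA.
Qed.

(** The three point masses are the three terms of the bracket of [A_{a,m}] and
[A_{b,n}]: by [img_sigma] the two points where the product in one of the two
orders survives carry the factors [chi c ^ m * chi a ^ - (m + n)] at
[c = a + b] and [chi c ^ m * chi (- a) ^ - (m + n)] at [c = - (a + b)]. *)
Lemma cov_sliceE a m b n c :
  cov_slice a m b n c =
  (c == a + b)%:R *: (chi (b *~ m - a *~ n) *: img (L (a + b) 0) (m + n))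
  + (c == - (a + b))%:R *:
      - (chi (a *~ n - b *~ m) *: img (L (a + b) 0) (m + n))
  + (c == 0)%:R *:
      ((m%:~R * (a + b == 0)%:R * (m + n == 0)%:R) *: cov_k cov).
Proof.
rewrite /cov_slice -[lie _ _]/(Lmul _ _ - Lmul _ _) !LmulE LformE.
rewrite addr0 subr0 sub0r (addrC b a) (eq_sym _ (- c)) eqr_oppLR.
rewrite (eq_sym (a + b) c).
rewrite cov_imgD cov_imgN !cov_imgZ (img_sigma _ a) (img_sigma _ (b + c)).
have ch x y k l : chi x ^ k * chi y ^ l = chi (x *~ k + y *~ l).
  by rewrite charD !charMz.
rewrite 2!scalerDr; congr (_ + _ + _).
- have [->|_] := eqVneq; last by rewrite !scale0r scaler0.
  rewrite !scale1r scalerA ch; congr (chi _ *: _).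
  by rewrite mulrNz mulrzDr mulrzDl opprD addrA [a *~ m + _]addrC addrK.
- have [->|_] := eqVneq; last by rewrite !scale0r oppr0 scaler0.
  rewrite !scale1r scalerN scalerA ch; congr (- (chi _ *: _)).
  rewrite (opprD a) addrCA subrr addr0 -opprD mulrNz !mulNrz opprK.
  by rewrite mulrzDr mulrzDl opprD addrACA addNr add0r addrC.
have [->|_] := eqVneq c 0; last by rewrite !(mulr0, mul0r) !scale0r scaler0.
by rewrite char0 exp1rz !scale1r !mulr1.
Qed.

(** Either coset of the translations contributes one bracket of [Ahat]. Extending
the slices by zero off the coset [e] lets the two contributions be added as sums
over the same index type. *)
Lemma fsum_cov_slice a m b n e
    (F := fun x : SD S => if x.2 == e then cov_slice a m b n x.1 else 0) :
  fin_supp F /\ \sum_(x \in [set: SD S]%classic) F x =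
    A_to_cov (lie (Agen chi a m) (Agen chi b n)).
Proof.
rewrite lie_Agen linearD !linearZ /= A_to_cov_gen A_to_cov_c scalerBl.
apply: (@fsum_point3 _ _ _ (a + b, e) (- (a + b), e) (0, e)) => -[c f].
rewrite /F /= cov_sliceE !xpair_eqE.
by case: (f == e); rewrite ?andbT // !andbF !scale0r !addr0.
Qed.

Lemma lie_img a m b n :
  lie (img (L a 0) m) (img (L b 0) n) =
  A_to_cov (lie (Agen chi a m + tauD (Agen chi a m)) (Agen chi b n)).
Proof.
have [fin0 sum0] := fsum_cov_slice a m b n false.
have [fin1 sum1] := fsum_cov_slice (- a) m b n true.
pose k := - chi (a *+ 2).
have -> : A_to_cov (lie (Agen chi a m + tauD (Agen chi a m)) (Agen chi b n)) =
    A_to_cov (lie (Agen chi a m) (Agen chi b n))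
    + k *: A_to_cov (lie (Agen chi (- a) m) (Agen chi b n)).
  by rewrite lieDl linearD tauD_A -scaleNr lieZl linearZ.
rewrite lie_cov_img.
apply: etrans (f_equal2 +%R sum0 (congr1 ( *:%R k) sum1)).
rewrite (fsum_morph (scaler0 C k) (scalerDr k) fin1).
have fin1k := @fin_supp_morph _ C C (fun=> *:%R k) _ (fun=> scaler0 C k) fin1.
rewrite -(fsumD fin0 fin1k).
apply: eq_fsbigr => -[c e] _; rewrite cov_term_slice /=.
case: e => /=; first by rewrite add0r scaleNr.
by rewrite scaler0 addr0.
Qed.

Lemma A_to_cov_lie u v :
  lie (A_to_cov u) (A_to_cov v) = A_to_cov (lie (u + tauD u) v).
Proof.
elim/Ahat_ind: u => [|c u u' IH IH'||a m].
- by rewrite !linear0 addr0 !lie0l linear0.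
- by rewrite !linearP /= lieDZl IH IH' addrACA -scalerDr lieDZl linearP.
- by rewrite A_to_cov_c cov_k_lie_l tauD_c lieDl lie_Ac_l addr0 linear0.
elim/Ahat_ind: v => [|c v v' IH IH'||b n].
- by rewrite linear0 !lie0r linear0.
- by rewrite linearP /= !lieDZr IH IH' linearP.
- by rewrite A_to_cov_c cov_k_lie_r lie_Ac_r linear0.
apply: etrans (lie_img a m b n).
exact: f_equal2 (A_to_cov_gen a m) (A_to_cov_gen b n).
Qed.

(** The factor 1/2 compensates [val (Dgen chi a m)] being a sum of two elements
with the same image under [A_to_cov]. *)
Definition D_to_cov (u : D) : C := 2^-1 *: A_to_cov (val u).
Fact D_to_cov_linear : linear D_to_cov.
Proof.
move=> c u v; rewrite /D_to_cov [val _]linearP linearP scalerDr !scalerA.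
by rewrite mulrC.
Qed.
HB.instance Definition _ :=
  GRing.isLinear.Build K D C _ D_to_cov D_to_cov_linear.

Lemma D_to_cov_sym u : D_to_cov (D_sym u) = A_to_cov u.
Proof.
rewrite /D_to_cov /= linearD /= A_to_cov_tau -mulr2n -scaler_nat scalerA.
by rewrite mulVf ?two_neq0 // scale1r.
Qed.

Lemma D_to_cov_c : D_to_cov (Dc chi) = 2^-1 *: cov_k cov.
Proof. by rewrite /D_to_cov A_to_cov_c. Qed.

Lemma D_to_cov_gen a m : D_to_cov (Dgen chi a m) = img (L a 0) m.
Proof. by rewrite -D_sym_gen D_to_cov_sym A_to_cov_gen. Qed.

Lemma D_to_cov_lie u v : D_to_cov (lie u v) = lie (D_to_cov u) (D_to_cov v).
Proof.
rewrite /D_to_cov lieZl lieZr A_to_cov_lie tauD_val -[lie u v]/(Dlie u v) /=.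
rewrite lieDl linearD -mulr2n -[in RHS]scaler_nat !scalerA.
by rewrite mulfVK ?two_neq0.
Qed.

Definition L_to_D (m : int) : LS K S -> D :=
  lin_ext (fun x : S * S => chi x.2 ^ (- m) *: Dgen chi x.1 m).
Fact L_to_D_linear m : linear (L_to_D m).
Proof. exact: lin_ext_linear. Qed.
HB.instance Definition _ m :=
  GRing.isLinear.Build K (LS K S) D _ (L_to_D m) (L_to_D_linear m).

Lemma L_to_D_gen m a b : L_to_D m (L a b) = chi b ^ (- m) *: Dgen chi a m.
Proof. exact: lin_extU. Qed.

(** The maps [L_to_D m] are constant on twisted orbits: for translations the
factor [chi b ^ - m] compensates the twist, for the involution this is
[D_tau_gen]. *)
Lemma L_to_D_act m x a : SD_char chi x ^ m *: L_to_D m (SD_act chi x a) = L_to_D m a.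
Proof.
elim/LS_ind: a => [|c u v IH IH'|a b].
- by rewrite SD_act0 linear0 scaler0.
- rewrite SD_actDZ !L_to_D_linear scalerDr IH' -[in RHS]IH !scalerA.
  by rewrite (mulrC c).
have sigE e : chi x.1 ^ m *: L_to_D m (sigma x.1 (L e b)) = L_to_D m (L e b).
  rewrite sigmaE !L_to_D_gen scalerA charD expfzMl mulrCA.
  by rewrite -expfzDr ?char_neq0 // subrr expr0z mulr1.
rewrite /SD_char /SD_act; case: x.2; last exact: sigE.
rewrite tau_chiE -scaleNr linearZ /= linearZ /= scalerA mulrC -scalerA sigE.
by rewrite !L_to_D_gen scalerA mulrC -scalerA scaleNr D_tau_gen.
Qed.

Definition affine_to_D : {linear affine (LS K S : lieType K) -> D} :=
  affine_ext L_to_D (2 *: Dc chi).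

Lemma affine_to_D_tens a m : affine_to_D (tens a m) = L_to_D m a.
Proof. exact: affine_ext_tens. Qed.

Lemma affine_to_D_k : affine_to_D aff_k = 2 *: Dc chi.
Proof. exact: affine_ext_k. Qed.

Lemma affine_to_D_act x a m :
  cov_char cov x ^ m *: affine_to_D (tens (cov_act cov x a) m)
  = affine_to_D (tens a m).
Proof. rewrite !affine_to_D_tens; exact: L_to_D_act. Qed.

Definition cov_to_D : C -> D := cov_lift affine_to_D.

Lemma cov_to_D_pi u : cov_to_D (cov_pi cov u) = affine_to_D u.
Proof. exact: cov_liftE affine_to_D_act u. Qed.

Fact cov_to_D_linear : linear cov_to_D.
Proof. exact: cov_lift_linear affine_to_D_act. Qed.
HB.instance Definition _ :=
  GRing.isLinear.Build K C D _ cov_to_D cov_to_D_linear.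

Lemma cov_to_D_k : cov_to_D (cov_k cov) = 2 *: Dc chi.
Proof. by rewrite [LHS]cov_to_D_pi affine_to_D_k. Qed.

Lemma cov_to_D_img a b m :
  cov_to_D (img (L a b) m) = chi b ^ (- m) *: Dgen chi a m.
Proof.
by rewrite [LHS]cov_to_D_pi affine_to_D_tens L_to_D_gen.
Qed.

(** Checking the left inverse before restriction to [Dhat] makes it a statement
about the generators of [Ahat]. *)
Lemma A_to_covK u : cov_to_D (A_to_cov u) = D_sym u.
Proof.
elim/Ahat_ind: u => [|c u v IH IH'||a m]; first by rewrite !linear0.
- by rewrite A_to_cov_linear cov_to_D_linear D_sym_linear IH IH'.
- by rewrite A_to_cov_c cov_to_D_k D_sym_c.
by rewrite A_to_cov_gen cov_to_D_img char0 exp1rz scale1r D_sym_gen.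
Qed.

Lemma D_to_covK : cancel D_to_cov cov_to_D.
Proof. by move=> u; rewrite /D_to_cov linearZ /= A_to_covK D_sym_val. Qed.

Lemma cov_to_DK : cancel cov_to_D D_to_cov.
Proof.
elim/cov_piP => u; elim/affine_ind: u => [u v IH IH'|c|a m].
- by rewrite -[u]scale1r cov_piDZ cov_to_D_linear D_to_cov_linear IH IH'.
- rewrite -[c *: _]addr0 cov_piDZ cov_to_D_linear D_to_cov_linear.
  rewrite [cov_to_D (cov_pi _ aff_k)]cov_to_D_k -D_sym_c D_to_cov_sym A_to_cov_c.
  by rewrite cov_pi0 !linear0.
rewrite -/(img a m); elim/LS_ind: a => [|c u v IH IH'|a b].
- by rewrite /cov_img tens0 !linear0.
- by rewrite cov_imgD cov_imgZ cov_to_D_linear D_to_cov_linear IH IH'.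
by rewrite cov_to_D_img linearZ /= D_to_cov_gen -img_sigma.
Qed.

Lemma D_linear_eq (V : lmodType K) (f f' : {linear D -> V}) :
  f (Dc chi) = f' (Dc chi) ->
  (forall a m, f (Dgen chi a m) = f' (Dgen chi a m)) -> f =1 f'.
Proof.
move=> fc fg u; rewrite -[u]D_sym_val !linearZ /=; congr (_ *: _).
elim/Ahat_ind: (val u) => [|c v w IH IH'||a m]; first by rewrite !linear0.
- by rewrite D_sym_linear !linearP IH IH'.
- by rewrite D_sym_c !linearZ fc.
by rewrite D_sym_gen.
Qed.

End Isomorphism.

Theorem proposition4p8 (R : realType) (S : zmodType) (chi : character S R[i]) :
  exists f : {linear Dhat chi -> cov_alg (SD_covariant chi)},
    [/\ f (Dc chi) = 2^-1 *: cov_k (SD_covariant chi),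
        forall (alpha : S) (m : int),
          f (Dgen chi alpha m) = cov_img (SD_covariant chi) (Lgen alpha 0) m,
        lie_isomorphism f
      & forall f' : {linear Dhat chi -> cov_alg (SD_covariant chi)},
          f' (Dc chi) = 2^-1 *: cov_k (SD_covariant chi) ->
          (forall (alpha : S) (m : int),
             f' (Dgen chi alpha m)
             = cov_img (SD_covariant chi) (Lgen alpha 0) m) ->
          f' =1 f].
Proof.
exists (@D_to_cov _ _ chi); split.
- exact: D_to_cov_c.
- exact: D_to_cov_gen.
- split; first exact: D_to_cov_lie.
  by exists (@cov_to_D _ _ chi); [exact: D_to_covK | exact: cov_to_DK].
move=> f' fc fg; apply: D_linear_eq => [|a m].
  by rewrite fc [RHS]D_to_cov_c.
by rewrite fg [RHS]D_to_cov_gen.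
Qed.
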